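(* Let $W=\mathcal{S}_n$ with $S=\{s_1,\dots,s_{n-1}\}$ (type $A_{n-1}$), and let $J\subset S$ have size $m$. Then the squashing map $(I,p)\mapsto \mathbb{S}q(p)$ is a bijection $$\mathbb{S}q^J\colon \{(I,p)\mid I\subset S,\ p \text{ is a core } (I,J)\text{-coset}\}\to \mathcal{S}_{n-m}.$$ Moreover, for every core $(I,J)$-coset $p$, squashing induces a bijection $(p_1,\dots,p_k)\mapsto(\mathbb{S}q(p_1),\dots,\mathbb{S}q(p_k))$ from the set of atomic reduced expressions for $p$ to the set of ordinary reduced expressions of the permutation $\mathbb{S}q(p)$ in the simple reflections of $\mathcal{S}_{n-m}$.
   Context: $\mathcal{S}_n$ acts on $X=\{1<\dots<n\}$, $s_i=(i\ i{+}1)$, $\ell$ is the Coxeter length. For $I\subset S$, $W_I$ is the parabolic subgroup, $w_I$ its longest element, $\ell(I)=\ell(w_I)$. An $(I,J)$-coset is an element $p\in W_I\backslash W/W_J$ (with $(I,J)$ part of the data), with Bruhat-maximal element $\overline p$ and Bruhat-minimal element $\underline p$. It is a core coset if $I=\underline pJ\underline p^{-1}$. Composition: let $*$ be the $0$-Hecke (star) product on $W$ (so $s*w=sw$ if $\ell(sw)>\ell(w)$ and $s*w=w$ otherwise). For an $(I,J)$-coset $p$ and a $(J,K)$-coset $q$, $p*q$ is the $(I,K)$-coset $W_I(\overline p*\overline q)W_K$, and $\overline{p*q}=\overline p*\overline q$. It is reduced if $\overline{p}*\overline q=(\overline pw_J^{-1})\overline q$ with $\ell(\overline p*\overline q)=\ell(\overline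 p)-\ell(J)+\ell(\overline q)$. A longer composition $p_1*\cdots*p_k$ is reduced if each successive composition $(p_1*\cdots*p_i)*p_{i+1}$ is reduced. Atomic coset: for $M\subset S$, $s\in M$, $t=w_Msw_M$, the $(M\setminus\{s\},M\setminus\{t\})$-coset containing $w_M$. An atomic reduced expression for a core coset $p$ is a sequence $(p_1,\dots,p_k)$ of composable atomic cosets whose composition is reduced and equals $p$ (with $k=0$ allowed for the identity coset $W_I\in W_I\backslash W/W_I$). Squashing: for $J\subset S$ let $\sim_J$ be the equivalence relation on $X$ generated by $j\sim_J j+1$ whenever $s_j\in J$. Its classes $C^{(J)}_1<\dots<C^{(J)}_{n-m}$ ($m=\#J$) are contiguous intervals, so the ordered set $X/{\sim_J}$ is identified with $\{1<\dots<n-m\}$. For $I,J$ of size $m$, a permutation $y$ of $X$ is a block permutation relative to $I$ and $J$ if it sends each class $C_c^{(J)}$ by an order-preserving bijection onto some class $C_{c'}^{(I)}$; then $\mathbb{S}q(y)\in\mathcal{S}_{n-m}$ is the induced permutation $c\mapsto c'$. For a core $(I,J)$-coset $p$, $\underline p$ is a block permutation relative to $I$ and $J$, and $\mathbb{S}q(p):=\mathbb{S}q(\underline p)$. *)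

(* Defs.v *)
From HB Require Import structures.
From mathcomp Require Import all_boot all_fingroup.

Set Implicit Arguments.
Unset Strict Implicit.
Unset Printing Implicit Defensive.

Import GroupScope.

(* MathComp multiplies permutations from left to right: (u * v) x = v (u x).
   The symmetric group here acts on the left, so its product is composition
   of functions: (u ** v) x = u (v x). *)
Definition pmul (T : finType) (u v : {perm T}) : {perm T} := v * u.
Notation "u ** v" := (pmul u v) (at level 40, left associativity).

Definition wprod n (ws : seq 'S_n) : 'S_n := foldr (@pmul 'I_n) 1 ws.

Section CoxeterGroup.
Variable n : nat.
Implicit Types (i : 'I_n.-1) (s t u v w x y : 'S_n) (I J M P : {set 'S_n}).

Lemma low_subproof i : i < n.
Proof. by apply: leq_trans (ltn_ord i) (leq_pred n). Qed.

Lemma high_subproof i : i.+1 < n.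
Proof. by rewrite -ltn_predRL. Qed.

Definition sref i : 'S_n :=
  tperm (Ordinal (low_subproof i)) (Ordinal (high_subproof i)).

Definition simples : {set 'S_n} := [set sref i | i : 'I_n.-1].

Definition has_word k w :=
  [exists ws : k.-tuple 'S_n, all [in simples] ws && (wprod ws == w)].

Lemma wprod_cat (ws vs : seq 'S_n) : wprod (ws ++ vs) = wprod ws ** wprod vs.
Proof.
by elim: ws => [|a ws IH] /=; rewrite /pmul ?mulg1 // IH /pmul mulgA.
Qed.

Lemma has_wordM k l u v : has_word k u -> has_word l v -> exists m, has_word m (u ** v).
Proof.
move=> /existsP[a /andP[aS /eqP <-]] /existsP[b /andP[bS /eqP <-]].
exists (k + l)%N; apply/existsP; exists (cat_tuple a b).
by rewrite all_cat aS bS /= wprod_cat.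
Qed.

Lemma has_word_tperm (a b : 'I_n) : a < b -> exists k, has_word k (tperm a b).
Proof.
case: b => b; elim: b => [|b IH] //= lt_b_n le_ab.
have lt_b : b < n.-1 by rewrite ltn_predRL.
have sb : has_word 1 (sref (Ordinal lt_b)).
  apply/existsP; exists [tuple sref (Ordinal lt_b)].
  by rewrite /= andbT imset_f //= /pmul mul1g.
have lb : b < n by apply: ltn_trans lt_b_n.
have [eq_ab|ne_ab] := eqVneq (a : nat) b.
  exists 1%N; rewrite (_ : tperm _ _ = sref (Ordinal lt_b)) //.
  by congr tperm; apply: val_inj.
have lt_ab : a < b by rewrite ltn_neqAle ne_ab.
have [k wk] := IH lb lt_ab.
have [l wl] := has_wordM sb wk.
have [m wm] := has_wordM wl sb.
exists m; move: wm; congr (has_word _ _).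
rewrite /pmul -[X in X * _ = _](tpermV _ _) -conjgE tpermJ; congr tperm.
  by rewrite tpermD // -val_eqE /= ?(gtn_eqF lt_ab) // (gtn_eqF le_ab).
by rewrite (_ : Ordinal lb = Ordinal (low_subproof (Ordinal lt_b)));
  [rewrite tpermL; apply: val_inj | apply: val_inj].
Qed.

Lemma ex_word w : exists k, has_word k w.
Proof.
have [ts -> dts] := prod_tpermP w.
elim: ts dts => [_|[a b] ts IH] /=.
  by rewrite big_nil; exists 0%N; apply/existsP; exists [tuple]; rewrite /= eqxx.
case/andP=> /= ne_ab /IH[k wk]; rewrite big_cons.
have [l wl] : exists l, has_word l (tperm a b).
  by case: (ltngtP a b) => [/has_word_tperm||/val_inj] //;
    [rewrite tpermC => /has_word_tperm | move/eqP; rewrite (negPf ne_ab)].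
exact: has_wordM wk wl.
Qed.

Definition len w : nat := ex_minn (ex_word w).

Lemma has_word_len w : has_word (len w) w.
Proof. by rewrite /len; case: ex_minnP. Qed.

Definition reduced_word w (ws : seq 'S_n) : bool :=
  [&& all [in simples] ws, wprod ws == w & size ws == len w].

(* The choice of reduced word made here is immaterial for [star] below. *)
Definition redword w : seq 'S_n := xchoose (existsP (has_word_len w)).

Definition star_simple s w : 'S_n := if len w < len (s ** w) then s ** w else w.

Definition star u w : 'S_n := foldr star_simple w (redword u).

Definition reflections : {set 'S_n} :=
  [set w ** s ** w^-1 | w in [set: 'S_n], s in simples].

Definition bruhat_step x y :=
  [exists t in reflections, (y == x ** t) && (len x < len y)].

Definition bruhat : rel 'S_n := connect bruhat_step.

(* <<I>> is the parabolic subgroup W_I. *)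
Definition longest I : 'S_n := [arg max_(w > 1 in <<I>>) len w].

Definition double_coset I w J : {set 'S_n} :=
  [set u ** w ** v | u in <<I>>, v in <<J>>].

End CoxeterGroup.

Arguments simples n : clear implicits.

(* A double coset carries its pair (I, J) as data; a term of this type is an
   actual (I, J)-coset when it satisfies [is_coset]. *)
Record dcoset n := DCoset {
  lft : {set 'S_n};
  rgt : {set 'S_n};
  elts : {set 'S_n}
}.

Definition dcoset_tuple n (p : dcoset n) := (lft p, rgt p, elts p).

Lemma dcoset_tupleK n :
  cancel (@dcoset_tuple n) (fun q => DCoset q.1.1 q.1.2 q.2).
Proof. by case. Qed.

HB.instance Definition _ n :=
  Equality.copy (dcoset n) (can_type (@dcoset_tupleK n)).

Section Cosets.
Variable n : nat.
Implicit Types (I J M : {set 'S_n}) (s w : 'S_n) (p q : dcoset n).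

Definition coset_through I w J : dcoset n := DCoset I J (double_coset I w J).

Definition is_coset p :=
  [&& lft p \subset simples n, rgt p \subset simples n
    & [exists w, p == coset_through (lft p) w (rgt p)]].

(* Bruhat-maximal and Bruhat-minimal elements; the default 1 is never used
   on an actual coset. *)
Definition top p : 'S_n :=
  odflt 1 [pick x in elts p | [forall y in elts p, bruhat y x]].

Definition bot p : 'S_n :=
  odflt 1 [pick x in elts p | [forall y in elts p, bruhat x y]].

Definition core p :=
  is_coset p && (lft p == [set bot p ** s ** (bot p)^-1 | s in rgt p]).

Definition id_coset I : dcoset n := coset_through I 1 I.

Definition compose p q : dcoset n :=
  coset_through (lft p) (star (top p) (top q)) (rgt q).

(* The length condition is stated without subtraction. *)
Definition reduced_comp p q :=
  let wJ := longest (rgt p) in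
  (star (top p) (top q) == top p ** wJ^-1 ** top q)
  && (len (star (top p) (top q)) + len wJ == len (top p) + len (top q))%N.

Fixpoint reduced_from p (e : seq (dcoset n)) : bool :=
  if e is q :: e' then
    [&& rgt p == lft q, reduced_comp p q & reduced_from (compose p q) e']
  else true.

Definition atomic_coset M s : dcoset n :=
  let wM := longest M in
  coset_through (M :\ s) wM (M :\ (wM ** s ** wM)).

Definition atomic p :=
  [exists M : {set 'S_n}, exists s : 'S_n,
    [&& M \subset simples n, s \in M & p == atomic_coset M s]].

Definition atomic_rex p (e : seq (dcoset n)) : bool :=
  if e is p1 :: e' then
    [&& all atomic e, reduced_from p1 e' & foldl compose p1 e' == p]
  else p == id_coset (lft p).

End Cosets.

Section Squash.
Variable n : nat.
Implicit Types (I J : {set 'S_n}) (x y : 'I_n) (C D : {set 'I_n}).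

Definition adj J x y := (y == x.+1 :> nat) && (tperm x y \in J).

Definition sim J : rel 'I_n := connect (fun x y => adj J x y || adj J y x).

Definition blocks J : {set {set 'I_n}} :=
  equivalence_partition (sim J) [set: 'I_n].

Definition block_lt C D := [forall x in C, forall y in D, x < y].

(* Blocks are numbered from 0: [block J c] is the block with exactly c blocks
   before it. *)
Definition block J (c : nat) : {set 'I_n} :=
  odflt set0 [pick C in blocks J | #|[set D in blocks J | block_lt D C]| == c].

Definition block_map I J (w : 'S_n) m (f : 'S_(n - m)) :=
  [forall c : 'I_(n - m),
    (w @: block J c == block I (f c))
    && [forall x in block J c, forall y in block J c, (x < y) ==> (w x < w y)]].

(* The permutation induced by a block permutation relative to I and J, both of
   cardinality m. *)
Definition squash_perm m I J (w : 'S_n) : 'S_(n - m) :=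
  odflt 1 [pick f : 'S_(n - m) | block_map I J w f].

Definition squash m (p : dcoset n) : 'S_(n - m) :=
  squash_perm m (lft p) (rgt p) (bot p).

End Squash.

(* Main.v *)
Require Import Defs.
From HB Require Import structures.
From mathcomp Require Import all_boot all_fingroup.
From mathcomp Require Import zify.

Set Implicit Arguments.
Unset Strict Implicit.
Unset Printing Implicit Defensive.

(* A core coset p is determined by its minimal element, which maps blocks to
   blocks monotonically, and its maximal element is the minimal one times the
   longest element of the right parabolic. Hence p * q is reduced exactly when
   the lengths of the two minimal elements add, in which case their product is
   the minimal element of p * q. Lengths add iff every pair inverted by the
   second factor stays inverted by the product, a condition that only depends
   on the permutations of the blocks; so reducedness can be tested after
   squashing. Atomic cosets squash to simple reflections, and conversely, for a
   given right parabolic, every simple reflection lifts to a unique atomic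
   coset. Lifting a reduced word letter by letter from the right thus inverts
   squashing, both on core cosets and on expressions.

   Bruhat-extremal elements of double cosets come from the operators that raise
   (or lower) the length by a simple reflection: left and right operators
   commute, which makes the extremal element unique and also makes the star
   product independent of reduced words. *)
Import GroupScope.

(** * Coxeter length as number of inversions *)

Section Length.
Variable n : nat.
Implicit Types (a b c d : 'I_n) (s t u v w x y : 'S_n) (J : {set 'S_n}).

Lemma pmulE u v a : (u ** v) a = u (v a).
Proof. by rewrite /pmul permM. Qed.

Lemma pmulA : associative (@pmul 'I_n).
Proof. by move=> u v w; rewrite /pmul mulgA. Qed.

Lemma pmul1p : left_id 1 (@pmul 'I_n).
Proof. by move=> u; rewrite /pmul mulg1. Qed.

Lemma pmulp1 : right_id 1 (@pmul 'I_n).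
Proof. by move=> u; rewrite /pmul mul1g. Qed.

Lemma simpleP s :
  reflect (exists a b, b = a.+1 :> nat /\ s = tperm a b) (s \in simples n).
Proof.
apply: (iffP imsetP) => [[i _ ->]|[a [b [ab ->]]]].
  by exists (Ordinal (low_subproof i)), (Ordinal (high_subproof i)).
have lt_a : a < n.-1 by have := ltn_ord b; lia.
by exists (Ordinal lt_a) => //; congr tperm; apply: val_inj.
Qed.

Lemma simple_tperm a b : b = a.+1 :> nat -> tperm a b \in simples n.
Proof. by move=> ab; apply/simpleP; exists a, b. Qed.

Lemma simpleV s : s \in simples n -> s^-1 = s.
Proof. by case/simpleP => a [b [_ ->]]; rewrite tpermV. Qed.

Lemma simpleK s w : s \in simples n -> s ** (s ** w) = w.
Proof. by move=> /simpleV {1}<-; rewrite /pmul mulgK. Qed.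

Lemma simpleKr s w : s \in simples n -> w ** s ** s = w.
Proof. by move=> /simpleV {2}<-; rewrite /pmul mulKg. Qed.

Definition ninv w := \sum_(a < n) \sum_(b < n) ((a < b) && (w b < w a)).

(** The defect of length additivity: pairs inverted by [v] that [u] puts back in order. *)
Definition nundo u v :=
  \sum_(a < n) \sum_(b < n) [&& a < b, v b < v a & u (v a) < u (v b)].

Lemma ord_eqE a b : (a == b) = (a == b :> nat).
Proof. by []. Qed.

Lemma perm_val_eq w a b : (w a == w b :> nat) = (a == b :> nat).
Proof. by rewrite !(inj_eq val_inj) (inj_eq perm_inj). Qed.

(* A pair inverted by v is either still inverted by u ** v, or u inverts it back. *)
Lemma ninvM u v : ninv (u ** v) + (nundo u v).*2 = (ninv u + ninv v)%N.
Proof.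
have -> : ninv u = \sum_(a < n) \sum_(b < n) ((v a < v b) && (u (v b) < u (v a))).
  rewrite /ninv (reindex_inj (@perm_inj _ v)); apply: eq_bigr => a _.
  by rewrite (reindex_inj (@perm_inj _ v)).
(* Transposing one of the two copies of [nundo] makes the identity hold separately for each ordered
   pair of points. *)
rewrite -addnn {2}/nundo exchange_big /= /ninv /nundo -!big_split /=.
apply: eq_bigr => a _; rewrite -!big_split /=; apply: eq_bigr => b _.
rewrite !pmulE; have := perm_val_eq v a b; have := perm_val_eq u (v a) (v b).
by lia.
Qed.

Lemma ninv1 : ninv 1 = 0.
Proof.
by rewrite /ninv big1 // => a _; rewrite big1 // => b _; rewrite !perm1; lia.
Qed.

Lemma simple_lt a b c d : b = a.+1 :> nat -> c < d ->
  (tperm a b d < tperm a b c) = (c == a) && (d == b).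
Proof.
move=> ab cd; rewrite ?ord_eqE.
by do 2![case: tpermP => [/(congr1 val)/=|/(congr1 val)/=|/eqP + /eqP]];
  rewrite ?ord_eqE; lia.
Qed.

Lemma sum_pair_pred1 (f : 'I_n -> 'I_n -> bool) a b :
  (forall c d, f c d -> c = a /\ d = b) ->
  \sum_c \sum_d (f c d : nat) = f a b.
Proof.
move=> fP; rewrite (bigD1 a) //= [X in (_ + X)%N]big1 => [|c ne]; last first.
  by apply: big1 => d _; case: (boolP (f c d)) => // /fP[/eqP]; rewrite (negPf ne).
rewrite (bigD1 b) //= big1 ?addn0 // => c ne.
by case: (boolP (f a c)) => // /fP[_ /eqP]; rewrite (negPf ne).
Qed.

Lemma ninv_simple a b : b = a.+1 :> nat -> ninv (tperm a b) = 1%N.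
Proof.
move=> ab; rewrite /ninv (sum_pair_pred1 (a := a) (b := b)) ?tpermL ?tpermR ?ab ?ltnSn //.
by move=> c d /andP[cd]; rewrite simple_lt // => /andP[/eqP-> /eqP->].
Qed.

(** The doubled boolean covers both a gain and a loss of one inversion without subtraction. *)
Lemma ninvMr a b w : b = a.+1 :> nat ->
  ninv (w ** tperm a b) + (w b < w a).*2 = (ninv w).+1.
Proof.
move=> ab; have /esym := ninvM w (tperm a b); rewrite (ninv_simple ab) addn1 => ->.
congr (_ + _.*2)%N.
rewrite /nundo (sum_pair_pred1 (a := a) (b := b)) ?tpermL ?tpermR ?ab ?ltnSn //.
by move=> c d /and3P[cd]; rewrite simple_lt // => /andP[/eqP-> /eqP->].
Qed.

(** A strictly increasing permutation moves no point down, and its inverse is strictly increasing as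
    well. *)
Lemma incr_perm1 w : {homo w : a b / a < b} -> w = 1.
Proof.
move=> wP; have ge v : {homo v : a b / a < b} -> forall a, a <= (v : 'S_n) a.
  move=> vP a; have [k] := ubnP (a : nat); elim: k a => // k IH [[|a] lt_a] //= ltk.
  have lt_a' : a < n by apply: ltnW.
  have := IH (Ordinal lt_a') ltk; have /= := vP (Ordinal lt_a') (Ordinal lt_a) (ltnSn _).
  by lia.
have wVP : {homo w^-1 : a b / a < b}.
  move=> a b ab; have := perm_val_eq w^-1 a b.
  have := wP (w^-1 b) (w^-1 a); rewrite !permKV; lia.
apply/permP => a; rewrite perm1; apply: val_inj => /=.
by have := ge _ wP a; have := ge _ wVP (w a); rewrite permK; lia.
Qed.

(** Comparisons of neighbours chain up along an interval as long as [P] passes to subintervals.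
    Below, [P] is either always true or says that two points share a block. *)
Lemma incr_steps (P : rel 'I_n) w (asc : bool) :
    (forall a b c, a < b -> b < c -> P a c -> P a b /\ P b c) ->
    (forall a b, b = a.+1 :> nat -> P a b -> (w a < w b) = asc) ->
  forall a b, a < b -> P a b -> (w a < w b) = asc.
Proof.
move=> Pconv step a [b]; elim: b => // b IH lt_b /= lt_ab.
have lt_b' : b < n by apply: ltnW.
have [ab|le_ba] := ltnP a b; last by apply: step => /=; lia.
move=> Pab; have [P1 P2] := Pconv _ (Ordinal lt_b') (Ordinal lt_b) ab (ltnSn b) Pab.
  have := IH lt_b' ab P1; have := step (Ordinal lt_b') (Ordinal lt_b) erefl P2.
  have := perm_val_eq w a (Ordinal lt_b'); have := perm_val_eq w a (Ordinal lt_b).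
  have := perm_val_eq w (Ordinal lt_b') (Ordinal lt_b) => /=; lia.
Qed.


Lemma ex_descent w : w != 1 -> exists a b, b = a.+1 :> nat /\ w b < w a.
Proof.
move=> w1; suff /existsP[a /existsP[b /andP[/eqP ab lt]]] :
  [exists a : 'I_n, exists b : 'I_n, ((b : nat) == a.+1) && (w b < w a)] by exists a, b.
apply/contraNT: w1 => /existsPn no; apply/eqP/incr_perm1 => a b ab.
apply/idP; apply: (@incr_steps (fun _ _ => true)) => // {}a {}b {}ab _.
have /existsPn/(_ b) := no a; rewrite ab eqxx /= -leqNgt.
by have := perm_val_eq w a b; lia.
Qed.

Lemma has_word1 s : s \in simples n -> has_word 1 s.
Proof. by move=> sS; apply/existsP; exists [tuple s]; rewrite /= sS pmulp1 /=. Qed.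

Lemma has_word_cat k l u v : has_word k u -> has_word l v -> has_word (k + l) (u ** v).
Proof.
move=> /existsP[a /andP[aS /eqP <-]] /existsP[b /andP[bS /eqP <-]].
by apply/existsP; exists (cat_tuple a b); rewrite all_cat aS bS /= wprod_cat.
Qed.

(** Bubble sort: while [w] is not the identity it has a descent, and removing it on the right costs
    one inversion and one letter. *)
Lemma ninv_has_word w : has_word (ninv w) w.
Proof.
have [k] := ubnP (ninv w); elim: k w => // k IH w lt_k.
have [->|/ex_descent[a [b [ab ba]]]] := eqVneq w 1.
  by rewrite ninv1; apply/existsP; exists [tuple]; rewrite /=.
have /esym := ninvMr w ab; rewrite ba -muln2 mul1n addn2 => -[inv_w].
have sS := simple_tperm ab; rewrite inv_w -(simpleKr w sS) -addn1.
by apply: has_word_cat (has_word1 sS); rewrite simpleKr //; apply: IH; lia.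
Qed.

Lemma has_word_ninv k w : has_word k w -> ninv w <= k.
Proof.
case/existsP=> -[ws /= /eqP<- {k}] /andP[+ /eqP<- {w}].
elim: ws => [|s ws IH] /=; first by rewrite ninv1.
case/andP => /simpleP[a [b [ab ->]]] /IH.
have := ninvM (tperm a b) (wprod ws); rewrite (ninv_simple ab); lia.
Qed.

Lemma len_ninv w : len w = ninv w.
Proof.
rewrite /len; case: ex_minnP => k /has_word_ninv ge_k /(_ _ (ninv_has_word w)).
by lia.
Qed.

Lemma lenMr a b w : b = a.+1 :> nat ->
  len (w ** tperm a b) + (w b < w a).*2 = (len w).+1.
Proof. by move=> ab; rewrite !len_ninv ninvMr. Qed.

Lemma len1 : len (1 : 'S_n) = 0.
Proof. by rewrite len_ninv ninv1. Qed.

Lemma len_simple s : s \in simples n -> len s = 1%N.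
Proof. by case/simpleP => a [b [ab ->]]; rewrite len_ninv ninv_simple. Qed.

Lemma lenM u v : len (u ** v) <= len u + len v.
Proof. by rewrite !len_ninv; have := ninvM u v; lia. Qed.

(** By [ninvM], lengths add exactly when the defect [nundo u v] vanishes. *)
Lemma lenM_add u v :
  reflect (forall a b, a < b -> v b < v a -> u (v b) < u (v a))
          (len (u ** v) == len u + len v)%N.
Proof.
have -> : (len (u ** v) == len u + len v)%N = (nundo u v == 0).
  by rewrite !len_ninv -ninvM; lia.
apply: (iffP eqP) => [/eqP|undo0].
  rewrite sum_nat_eq0 => /forallP/= H a b ab ba; have := H a.
  rewrite sum_nat_eq0 => /forallP/(_ b) /=; rewrite ab ba /= eqb0 -leqNgt.
  by have := perm_val_eq u (v a) (v b); have := perm_val_eq v a b; lia.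
apply: big1 => a _; apply: big1 => b _; apply/eqP; rewrite eqb0; apply/negP.
by case/and3P => ab ba; have := undo0 a b ab ba; lia.
Qed.

Lemma lenV w : len w^-1 = len w.
Proof.
rewrite !len_ninv /ninv (reindex_inj (@perm_inj _ w)) [RHS]exchange_big /=.
apply: eq_bigr => a _; rewrite (reindex_inj (@perm_inj _ w)) /=.
by apply: eq_bigr => b _; rewrite !permK andbC.
Qed.

Lemma pmulV u v : (u ** v)^-1 = v^-1 ** u^-1.
Proof. by rewrite /pmul invMg. Qed.

End Length.

(** * Parabolic subgroups and their blocks *)

(* Elaboration may insert [reverse_coercion] in the type of a permutation, which
   prevents lia from identifying its atoms. *)
Ltac olia := cbv beta delta [reverse_coercion] in *; lia.

Section Parabolic.
Variable n : nat.
Implicit Types (a b c d : 'I_n) (s t u v w x y : 'S_n) (I J : {set 'S_n}) (up : bool).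

Lemma pmul_tperm w c d : w ** tperm c d = tperm (w c) (w d) ** w.
Proof. by rewrite /pmul -tpermJ conjgE !mulgA mulgV mul1g. Qed.

Lemma lenlt_r a b w : b = a.+1 :> nat ->
  (len w < len (w ** tperm a b)) = (w a < w b).
Proof. by move=> ab; have := lenMr w ab; have := perm_val_eq w a b; lia. Qed.

Lemma lenltV s w : s \in simples n -> (len w < len (s ** w)) = (len w^-1 < len (w^-1 ** s)).
Proof. by move=> sS; rewrite -[len w]lenV -[len (s ** w)]lenV pmulV (simpleV sS). Qed.

Lemma lenlt_l a b w : b = a.+1 :> nat ->
  (len w < len (tperm a b ** w)) = (w^-1 a < w^-1 b).
Proof. by move=> ab; rewrite lenltV ?simple_tperm // lenlt_r. Qed.

Lemma lenlt_lr s t w : s \in simples n -> t \in simples n -> s ** w != w ** t ->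
  (len (w ** t) < len (s ** (w ** t))) = (len w < len (s ** w)).
Proof.
move=> /simpleP[a [b [ab ->]]] tS; rewrite !lenlt_l // pmulV !pmulE (simpleV tS).
case/simpleP: tS => c [d [cd ->]] ne.
case: (ltngtP (w^-1 a) (w^-1 b)) => [lt|lt|/val_inj/perm_inj eq_ab]; last by rewrite eq_ab; lia.
  have := simple_lt cd lt; case: eqP => [Ec|_]; case: eqP => [Ed|_] /=.
  - by move: ne; rewrite pmul_tperm -Ec -Ed !permKV eqxx.
  - by have := perm_val_eq (tperm c d) (w^-1 a) (w^-1 b); move: lt; olia.
  - by have := perm_val_eq (tperm c d) (w^-1 a) (w^-1 b); move: lt; olia.
  - by have := perm_val_eq (tperm c d) (w^-1 a) (w^-1 b); move: lt; olia.
have := simple_lt cd lt; case: eqP => [Ec|_] //; case: eqP => [Ed|_] //=.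
by move: ne; rewrite pmul_tperm -Ec -Ed !permKV tpermC eqxx.
Qed.

Lemma lenlt_rl s t w : s \in simples n -> t \in simples n -> s ** w != w ** t ->
  (len (s ** w) < len (s ** w ** t)) = (len w < len (w ** t)).
Proof.
move=> sS tS ne; rewrite -[len (s ** w)]lenV -[len (s ** w ** t)]lenV.
rewrite -[len w]lenV -[len (w ** t)]lenV !pmulV (simpleV sS) (simpleV tS).
apply: lenlt_lr => //; apply: contra_neq ne => /(congr1 invg).
by rewrite !pmulV !invgK (simpleV sS) (simpleV tS).
Qed.

(* For [up = true] the operators below raise the length whenever possible, for
   [up = false] they lower it; [rstable up J] says that no operator from [J]
   applies. Maximal and minimal coset elements are thus treated together. *)
Definition rop up t w := if (len w < len (w ** t)) == up then w ** t else w.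
Definition lop up s w := if (len w < len (s ** w)) == up then s ** w else w.

Lemma lenlt_invr t w : t \in simples n ->
  (len (w ** t) < len w) = ~~ (len w < len (w ** t)).
Proof. by case/simpleP => a [b [ab ->]]; have := lenMr w ab; lia. Qed.

(** If [s ** w] and [w ** t] differ, neither multiplication affects the length test of the other. If
    they agree, both operators make the same move, after which neither can move again. *)
Lemma lop_ropC up s t w : s \in simples n -> t \in simples n ->
  lop up s (rop up t w) = rop up t (lop up s w).
Proof.
move=> sS tS; have [E|ne] := eqVneq (s ** w) (w ** t); last first.
  have El := lenlt_lr sS tS ne; have Er := lenlt_rl sS tS ne.
  rewrite /lop /rop pmulA in El Er *; move: El Er; clear ne; move: (@len n) => L.
  case E2: ((L w < L (w ** t)) == up); case E1: ((L w < L (s ** w)) == up) => El Er;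
    by rewrite ?pmulA ?El ?Er ?E1 ?E2.
rewrite /lop /rop E; case E1: ((len w < len (w ** t)) == up); last by rewrite E E1.
have -> : s ** (w ** t) = w by rewrite -E simpleK.
by rewrite simpleKr // lenlt_invr //; case: up (_ < _) E1 => -[].
Qed.

Lemma rop_inv up t w : t \in simples n -> rop up t w = w -> rop up t (w ** t) = w.
Proof.
move=> tS; rewrite /rop simpleKr // lenlt_invr //.
case E: ((len w < len (w ** t)) == up) => wt.
  by rewrite wt if_same.
by case: up (_ < _) E => -[].
Qed.

Lemma lopE up s w : s \in simples n -> lop up s w = (rop up s w^-1)^-1.
Proof.
by move=> sS; rewrite /lop /rop lenltV //; case: ifP => _; rewrite ?pmulV ?invgK ?simpleV.
Qed.

Definition rstable up J w := [forall t in J, (len w < len (w ** t)) != up].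
Definition lstable up I w := [forall s in I, (len w < len (s ** w)) != up].

Lemma lstableV up I w : I \subset simples n -> lstable up I w = rstable up I w^-1.
Proof.
by move=> /subsetP IS; apply: eq_forallb_in => s sI; rewrite lenltV ?IS.
Qed.

(* [cut J a] says that [a] is the last point of its block, so that [bidx J a]
   numbers the block of [a], counting from 0. *)
Definition cut J a := ~~ [exists b, adj J a b].
Definition bidx J a := #|[set b : 'I_n | (b < a) && cut J b]|.

Lemma cutE J a b : b = a.+1 :> nat -> cut J a = (tperm a b \notin J).
Proof.
move=> ab; congr (~~ _); apply/existsP/idP => [[c /andP[/eqP cE]]|J_ab].
  by rewrite (_ : c = b) //; apply: val_inj; rewrite /= cE ab.
by exists b; rewrite /adj ab eqxx.
Qed.

Lemma bidxS J a b : b = a.+1 :> nat -> bidx J b = (bidx J a + (tperm a b \notin J))%N.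
Proof.
move=> ab; rewrite /bidx (cardsD1 a) inE -cutE // ab ltnSn addnC /=; congr (_ + _)%N.
by apply: eq_card => c; rewrite !inE ord_eqE; case: (cut J c); lia.
Qed.

Lemma bidx_mono J a b : a <= b -> bidx J a <= bidx J b.
Proof.
move=> ab; apply/subset_leq_card/subsetP => c; rewrite !inE => /andP[ca ->].
by rewrite (leq_trans ca ab).
Qed.

Lemma bidx_lt J a b : bidx J a < bidx J b -> a < b.
Proof. by have := @bidx_mono J b a; lia. Qed.

Lemma bidx_between J a b c : a <= b -> b <= c -> bidx J a = bidx J c -> bidx J b = bidx J a.
Proof. by move=> /(bidx_mono J) ab /(bidx_mono J) bc; lia. Qed.

Lemma bidx_eqS J a b : b = a.+1 :> nat -> (bidx J a == bidx J b) = (tperm a b \in J).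
Proof. by move=> ab; rewrite (bidxS J ab); case: (_ \in _); lia. Qed.

Definition bmono (asc : bool) J w :=
  forall a b, a < b -> bidx J a = bidx J b -> (w a < w b) = asc.

(** A letter of [J] swaps two neighbours of one block, and it raises the length iff [w] increases
    there; [incr_steps] extends this to the block. Right maximal elements thus decrease on blocks,
    and right minimal ones increase. *)
Lemma rstableP up J w : J \subset simples n ->
  reflect (bmono (~~ up) J w) (rstable up J w).
Proof.
move=> JS; apply: (iffP forall_inP) => [st a b ab /eqP|mono t tJ].
  apply: (incr_steps (P := fun a b => bidx J a == bidx J b)) a b ab.
    move=> a b c ab bc /eqP ac; rewrite (bidx_between (ltnW ab) (ltnW bc) ac) ac.
    by rewrite eqxx.
  move=> a b ab; rewrite bidx_eqS // => /st; rewrite lenlt_r //.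
  by case: up {st} => /=; case: (_ < _).
have /simpleP[a [b [ab tE]]] := subsetP JS t tJ.
rewrite tE lenlt_r // (mono a b) ?ab //; first by case: up {mono}.
by apply/eqP; rewrite bidx_eqS -?tE.
Qed.

Lemma gen_pind J (P : 'S_n -> Prop) :
  P 1 -> (forall s w, s \in J -> P w -> P (s ** w)) -> forall w, w \in <<J>> -> P w.
Proof.
move=> P1 PM w /gen_prodgP[k [c cJ ->]].
elim: k c cJ => [|k IH] c cJ; first by rewrite big_ord0.
(* The last factor of a MathComp product is the leftmost one for [**]. *)
by rewrite big_ord_recr /=; apply: PM => //; apply: IH => i; apply: cJ.
Qed.

Lemma gen_bidx J u a : J \subset simples n -> u \in <<J>> -> bidx J (u a) = bidx J a.
Proof.
move=> /subsetP JS uJ; elim/gen_pind: u / uJ a => [|s w sJ IH] a; first by rewrite perm1.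
rewrite pmulE -[RHS]IH; have /simpleP[b [c [bc sE]]] := JS s sJ.
have /eqP E : bidx J b == bidx J c by rewrite bidx_eqS // -sE.
by rewrite sE; case: tpermP => [->|->|].
Qed.

(** [u] preserves each block, so it keeps the order between blocks. Inside a block [w] and [w ** u]
    are monotone in the same sense, so [u] is increasing there too. *)
Lemma rstable_uniq up J u w : J \subset simples n -> u \in <<J>> ->
  rstable up J w -> rstable up J (w ** u) -> u = 1.
Proof.
move=> JS uJ /(rstableP _ _ JS) w_mono /(rstableP _ _ JS) wu_mono.
apply: incr_perm1 => a b ab; have := bidx_mono J (ltnW ab).
rewrite leq_eqVlt => /predU1P[E|]; last by rewrite -(gen_bidx a JS uJ) -(gen_bidx b JS uJ) => /bidx_lt.
have := wu_mono a b ab E; rewrite !pmulE; have := perm_val_eq u a b.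
case: (ltngtP (u a) (u b)) => // [lt|]; last by lia.
have := w_mono _ _ lt; rewrite !(gen_bidx _ JS uJ) E => /(_ erefl) <-.
by have := perm_val_eq w (u a) (u b); lia.
Qed.

End Parabolic.

(** * Extremal elements of double cosets *)

Section Extremal.
Variable n : nat.
Implicit Types (s t u v w x y z : 'S_n) (I J : {set 'S_n}) (up : bool) (e a b : seq 'S_n).

Definition ropw up w a := foldl (fun x t => rop up t x) w a.
Definition lopw up w b := foldr (lop up) w b.

Lemma sub_simples J a : J \subset simples n -> all [in J] a -> all [in simples n] a.
Proof. by move=> /subsetP JS; apply: sub_all. Qed.

Lemma lopw_ropC up t w b : t \in simples n -> all [in simples n] b ->
  lopw up (rop up t w) b = rop up t (lopw up w b).
Proof.
by move=> tS; elim: b => //= s b IH /andP[sS /IH->]; rewrite lop_ropC.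
Qed.

Lemma lopw_ropwC up w a b : all [in simples n] a -> all [in simples n] b ->
  lopw up (ropw up w a) b = ropw up (lopw up w b) a.
Proof.
move=> + bS; elim: a w => //= t a IH w /andP[tS aS].
by rewrite IH // lopw_ropC.
Qed.

Lemma ropwV up w a : all [in simples n] a -> (ropw up w a)^-1 = lopw up w^-1 (rev a).
Proof.
elim: a w => //= t a IH w /andP[tS aS].
by rewrite IH // rev_cons -cats1 /lopw foldr_cat /= lopE // invgK.
Qed.

Lemma lopwV up w b : all [in simples n] b -> (lopw up w b)^-1 = ropw up w^-1 (rev b).
Proof.
move=> bS; rewrite -[w in LHS]invgK -[b in LHS]revK -ropwV ?invgK //.
by rewrite all_rev.
Qed.

Lemma pmul_memr J u v : u \in <<J>> -> v \in <<J>> -> u ** v \in <<J>>.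
Proof. by move=> uJ vJ; apply: groupM. Qed.

Lemma ropw_mem up J w a : all [in J] a -> exists2 u, u \in <<J>> & ropw up w a = w ** u.
Proof.
elim: a w => [|t a IH] w /=; first by exists 1; rewrite ?group1 ?pmulp1.
case/andP => /mem_gen tJ aJ; have [u uJ ->] := IH (rop up t w) aJ.
rewrite /rop; case: ifP => _; last by exists u.
by exists (t ** u); rewrite ?pmul_memr ?pmulA.
Qed.

Lemma ropw_stable up J w : J \subset simples n ->
  exists2 a, all [in J] a & rstable up J (ropw up w a).
Proof.
move=> /subsetP JS; pose M := \max_(y : 'S_n) len y.
have lenM y : len y <= M by apply: leq_bigmax.
(* Every effective move lowers this potential; the bound [M] makes the subtraction faithful when
   lengths are raised. *)
pose pot x := if up then M - len x else len x.
have [k] := ubnP (pot w); elim: k w => // k IH w lt_k.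
have [st|/forall_inPn[t tJ]] := boolP (rstable up J w); first by exists [::].
rewrite negbK => E; case: (IH (w ** t)) => [|a aJ st]; last first.
  by exists (t :: a); rewrite /= ?tJ ?aJ /rop ?E.
move: lt_k; have := lenlt_invr w (JS t tJ).
have := lenM (w ** t); have := lenM w; move: E; rewrite /pot.
by case: up {IH pot} => /eqP lt; olia.
Qed.

Lemma ropw_fix up J w a : rstable up J w -> all [in J] a -> ropw up w a = w.
Proof.
move=> /forall_inP st; elim: a => //= t a IH /andP[/st/negPf tw /IH].
by rewrite /rop tw.
Qed.

Lemma rstable_coset up J w u v : J \subset simples n -> u \in <<J>> -> v \in <<J>> ->
  rstable up J (w ** u) -> rstable up J (w ** v) -> w ** u = w ** v.
Proof.
move=> JS uJ vJ su sv; have E : w ** v = w ** u ** (u^-1 ** v).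
  by rewrite /pmul !mulgA mulgKV.
rewrite E in sv *; rewrite (rstable_uniq JS _ su sv) ?pmulp1 //.
by rewrite pmul_memr ?groupV.
Qed.

(** Reachability by operators rather than by mere multiplication, so that each move goes the right
    way in the Bruhat order. *)
Definition reaches up I J y z :=
  exists a b, [/\ all [in J] a, all [in I] b & lopw up (ropw up y a) b = z].

(** If the operator of [t] fixes [y], it carries [y ** t] back to [y], and [t] is put in front of
    the word. Otherwise [y ** t] has already moved in the right direction, and the uniqueness of
    stable elements in a one-sided coset shows that its path still ends at [z]. *)
Lemma reaches_r up I J y z t : I \subset simples n -> J \subset simples n ->
    rstable up J z -> t \in J ->
  reaches up I J y z -> reaches up I J (y ** t) z.
Proof.
move=> IS JS st tJ [a [b [aJ bI zE]]]; have tS := subsetP JS t tJ.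
have [yt|yt] := eqVneq (rop up t y) y.
  by exists (t :: a), b; rewrite /= tJ (rop_inv tS yt).
have {yt} Eyt : y ** t = rop up t y.
  by move: yt; rewrite /rop; case: ifP; rewrite ?eqxx.
have aS := sub_simples JS aJ; have bS := sub_simples IS bI.
(* The word [a] may stop before stability when started one move later; [a'] completes it, after the
   left operators have been commuted to the front. *)
have [a' a'J st'] := ropw_stable up (ropw up (rop up t (lopw up y b)) a) JS.
exists (a ++ a'), b; rewrite all_cat aJ a'J bI; split => //.
rewrite Eyt lopw_ropwC ?all_cat ?aS ?(sub_simples JS a'J) // lopw_ropC //.
have taJ : all [in J] (t :: a ++ a') by rewrite /= tJ all_cat aJ.
have [u uJ uE] := ropw_mem up (lopw up y b) taJ.
have [v vJ vE] := ropw_mem up (lopw up y b) aJ.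
rewrite -[ropw up _ _]/(ropw up (lopw up y b) (t :: a ++ a')) uE.
rewrite -lopw_ropwC // zE in vE; rewrite vE in st *.
have st2 : rstable up J (lopw up y b ** u) by rewrite -uE /ropw /= foldl_cat; exact: st'.
exact: rstable_coset JS uJ vJ st2 st.
Qed.

Lemma reachesV up I J y z : I \subset simples n -> J \subset simples n ->
  reaches up I J y z -> reaches up J I y^-1 z^-1.
Proof.
move=> IS JS [a [b [aJ bI <-]]].
have aS := sub_simples JS aJ; have bS := sub_simples IS bI.
exists (rev b), (rev a); rewrite !all_rev; split => //.
by rewrite lopwV // ropwV // -lopw_ropwC ?all_rev.
Qed.

Lemma reaches_l up I J y z s : I \subset simples n -> J \subset simples n ->
    lstable up I z -> s \in I ->
  reaches up I J y z -> reaches up I J (s ** y) z.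
Proof.
move=> IS JS; rewrite lstableV // => st sI /(reachesV IS JS).
move=> /(reaches_r JS IS st sI)/(reachesV JS IS).
by rewrite pmulV !invgK (simpleV (subsetP IS s sI)).
Qed.

(** Any element of the double coset arises from [z] by multiplying with one letter at a time, and
    reachability of [z] survives each letter. *)
Lemma extremal_reaches up I J z u v : I \subset simples n -> J \subset simples n ->
    lstable up I z -> rstable up J z -> u \in <<I>> -> v \in <<J>> ->
  reaches up I J (u ** z ** v) z.
Proof.
move=> IS JS lz rz uI vJ; elim/gen_pind: u / uI => [|s u sI]; last first.
  by rewrite -!pmulA; apply: reaches_l.
rewrite pmul1p -[v]invgK; have : v^-1 \in <<J>> by rewrite groupV.
elim/gen_pind: v^-1 / => [|t w tJ].
  by exists [::], [::]; rewrite invg1 pmulp1.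
by rewrite pmulV (simpleV (subsetP JS t tJ)) pmulA; apply: reaches_r.
Qed.

(** * Comparison in the Bruhat order *)

Definition directed up x y := if up then bruhat x y else bruhat y x.

Lemma directed_trans up : transitive (directed up).
Proof.
by move=> y x z; rewrite /directed; case: up => ? ?; apply: (connect_trans (y := y)).
Qed.

Lemma bruhat_conj x y w s : s \in simples n -> y = x ** (w ** s ** w^-1) -> len x < len y ->
  bruhat x y.
Proof.
move=> sS -> lt; apply/connect1/existsP; exists (w ** s ** w^-1).
by rewrite eqxx lt !andbT; apply/imset2P; exists w s; rewrite ?inE.
Qed.

Lemma rop_directed up t w : t \in simples n -> directed up w (rop up t w).
Proof.
move=> tS; have bruhatR x y : y = x ** t -> len x < len y -> bruhat x y.
  by move=> E; apply: (@bruhat_conj x y 1 t); rewrite ?invg1 ?pmulp1 ?pmul1p.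
rewrite /rop /directed; case: up.
  by case: eqP => lt; [apply: bruhatR | apply: connect0].
case: eqP => lt; last exact: connect0.
by apply: bruhatR; rewrite ?simpleKr // lenlt_invr // lt.
Qed.

(** Inverting a step puts its reflection on the left; conjugating by [x] brings it back to the
    right. *)
Lemma bruhatV x y : bruhat x y -> bruhat x^-1 y^-1.
Proof.
case/connectP => p; elim: p x => [|z p IH] x /=; first by move=> _ ->; apply: connect0.
case/andP => /exists_inP[t /imset2P[w s _ sS ->]] /andP[/eqP zE lt] /IH{}IH /IH.
apply: connect_trans; apply: (@bruhat_conj _ _ (x ** w) s) => //; last by rewrite !lenV.
by rewrite zE !pmulV (simpleV sS) invgK /pmul !mulgA mulgK.
Qed.

Lemma lop_directed up s w : s \in simples n -> directed up w (lop up s w).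
Proof.
move=> sS; rewrite lopE //; have := rop_directed up w^-1 sS.
by rewrite /directed; case: up => /bruhatV; rewrite invgK.
Qed.

Lemma reaches_directed up I J y z : I \subset simples n -> J \subset simples n ->
  reaches up I J y z -> directed up y z.
Proof.
move=> IS JS [a [b [/(sub_simples JS) aS /(sub_simples IS) bS <-]]].
have dxx x : directed up x x by rewrite /directed if_same; apply: connect0.
apply: (@directed_trans _ (ropw up y a)).
  elim: a y aS => //= t a IH y /andP[tS aS].
  by apply: directed_trans (IH _ aS); apply: rop_directed.
elim: b bS => //= s b IH /andP[sS bS].
by apply: directed_trans (IH bS) _; apply: lop_directed.
Qed.

Lemma bruhat_len x y : bruhat x y -> x = y \/ len x < len y.
Proof.
case/connectP => p; elim: p x => [|z p IH] x /=; first by left.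
by case/andP => /exists_inP[t _ /andP[_ lt]] /IH{}IH /IH[<-|]; right => //; apply: ltn_trans lt _.
Qed.

Lemma bruhat_anti x y : bruhat x y -> bruhat y x -> x = y.
Proof. by move=> /bruhat_len[//|xy] /bruhat_len[//|yx]; lia. Qed.

Lemma directed_anti up x y : directed up x y -> directed up y x -> x = y.
Proof. by rewrite /directed; case: up => ? ?; apply: bruhat_anti. Qed.

Lemma double_cosetP I w J y :
  reflect (exists u v, [/\ u \in <<I>>, v \in <<J>> & y = u ** w ** v])
          (y \in double_coset I w J).
Proof.
by apply: (iffP imset2P) => [[u v]|[u [v []]]]; [exists u, v | exists u v].
Qed.

Lemma double_coset_refl I w J : w \in double_coset I w J.
Proof. by apply/double_cosetP; exists 1, 1; rewrite !group1 pmulp1 pmul1p. Qed.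

Lemma double_coset_eq I w J y :
  y \in double_coset I w J -> double_coset I y J = double_coset I w J.
Proof.
case/double_cosetP => u [v [uI vJ yE]]; have wE : w = u^-1 ** y ** v^-1.
  by rewrite yE /pmul !mulgA mulVg mul1g mulgK.
apply/setP => z; apply/double_cosetP/double_cosetP => -[u' [v' [u'I v'J zE]]].
  exists (u' ** u), (v ** v'); rewrite !pmul_memr //; split=> //.
  by rewrite zE yE !pmulA.
exists (u' ** u^-1), (v^-1 ** v'); rewrite !pmul_memr ?groupV //; split=> //.
by rewrite zE wE !pmulA.
Qed.

(** Unfolds to [top] for [up = true] and to [bot] for [up = false]. *)
Definition extremal up (p : dcoset n) :=
  odflt 1 [pick x in elts p | [forall y in elts p, directed up y x]].

(** A two-sided stable element is reached from the whole coset, hence bounds it; antisymmetry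
    identifies it with the picked element. *)
Lemma extremal_eq up (p : dcoset n) z : is_coset p -> z \in elts p ->
  lstable up (lft p) z -> rstable up (rgt p) z -> extremal up p = z.
Proof.
case: p => I J E /and3P[/= IS JS /existsP[w /eqP[->]]] zE lz rz.
have max_z y : y \in double_coset I w J -> directed up y z.
  rewrite -(double_coset_eq zE) => /double_cosetP[u [v [uI vJ ->]]].
  exact: reaches_directed (extremal_reaches IS JS lz rz uI vJ).
rewrite /extremal /=; case: pickP => [x /andP[xE /forall_inP max_x]|/(_ z)] /=.
  exact: directed_anti (max_z _ xE) (max_x _ zE).
by rewrite zE /=; case/forall_inP.
Qed.

Lemma double_cosetMr I w J y v : v \in <<J>> ->
  y \in double_coset I w J -> y ** v \in double_coset I w J.
Proof.
move=> vJ /double_cosetP[u [v' [uI v'J ->]]]; apply/double_cosetP.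
by exists u, (v' ** v); rewrite pmul_memr // pmulA.
Qed.

Lemma double_cosetMl I w J y u : u \in <<I>> ->
  y \in double_coset I w J -> u ** y \in double_coset I w J.
Proof.
move=> uI /double_cosetP[u' [v' [u'I v'J ->]]]; apply/double_cosetP.
by exists (u ** u'), v'; rewrite pmul_memr // !pmulA.
Qed.

(** An element of extreme length in the coset is stable on both sides. *)
Lemma extremalP up (p : dcoset n) : is_coset p ->
  [/\ extremal up p \in elts p, lstable up (lft p) (extremal up p)
    & rstable up (rgt p) (extremal up p)].
Proof.
move=> pC; suff [z [zE lz rz]] :
    exists z, [/\ z \in elts p, lstable up (lft p) z & rstable up (rgt p) z].
  by rewrite (extremal_eq pC zE lz rz).
case: p pC => I J E /and3P[/= IS JS /existsP[w /eqP[->]]].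
pose M := \max_(y : 'S_n) len y.
have lenM y : len y <= M by apply: leq_bigmax.
pose pot x := if up then len x else M - len x.
case: (arg_maxnP pot (double_coset_refl I w J)) => z zE max_z.
have stable y : y \in double_coset I w J -> (len y < len z) = ~~ (len z < len y) ->
    (len z < len y) != up.
  move=> yE; have := max_z y yE; have := lenM y; have := lenM z; rewrite /pot.
  move: (len y) (len z) => ly lz; case: up {pot max_z} => /= ? ? ? ?; apply/eqP; lia.
exists z; split=> //; apply/forall_inP => s sIJ; apply: stable.
- by apply: double_cosetMl => //; apply: mem_gen.
- have sS := subsetP IS s sIJ; rewrite -[len (s ** z)]lenV -[len z]lenV pmulV (simpleV sS).
  exact: lenlt_invr.
- by apply: double_cosetMr => //; apply: mem_gen.
- exact/lenlt_invr/(subsetP JS).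
Qed.

End Extremal.

(** * Star product and reduced composition *)

Section Star.
Variable n : nat.
Implicit Types (s t u v w x y z : 'S_n) (I J K : {set 'S_n}) (a b : seq 'S_n).
Implicit Types (p q : dcoset n).

Lemma topE p : top p = extremal true p. Proof. by []. Qed.

Lemma longest_spec J : longest J \in <<J>> /\ {in <<J>>, forall u, len u <= len (longest J)}.
Proof. by rewrite /longest; case: arg_maxnP => [|z zJ max_z]; rewrite ?group1. Qed.

Lemma longest_mem J : longest J \in <<J>>.
Proof. by case: (longest_spec J). Qed.

Lemma longest_rstable J : rstable true J (longest J).
Proof.
case: (longest_spec J) => wJ max_w; apply/forall_inP => t /mem_gen tJ.
by rewrite eqb_id -leqNgt max_w // pmul_memr.
Qed.

Lemma longest_lstable J : lstable true J (longest J).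
Proof.
case: (longest_spec J) => wJ max_w; apply/forall_inP => t /mem_gen tJ.
by rewrite eqb_id -leqNgt max_w // pmul_memr.
Qed.

Lemma longest_uniq J u : J \subset simples n -> u \in <<J>> -> rstable true J u -> u = longest J.
Proof.
move=> JS uJ ru; have rl := longest_rstable J.
rewrite -[u]pmul1p -[RHS]pmul1p.
by apply: (rstable_coset JS uJ (longest_mem J)); rewrite pmul1p; [exact: ru | exact: rl].
Qed.

Lemma longestV J : J \subset simples n -> (longest J)^-1 = longest J.
Proof.
move=> JS; apply: longest_uniq; rewrite ?groupV ?longest_mem //.
by rewrite -lstableV // longest_lstable.
Qed.

(** [v] inverts only pairs inside a block of [J], and [x] is increasing there, so no inversion is
    undone. *)
Lemma len_rstableM J x v : J \subset simples n -> rstable false J x -> v \in <<J>> ->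
  len (x ** v) = (len x + len v)%N.
Proof.
move=> JS /(rstableP _ _ JS) x_mono vJ; apply/eqP/lenM_add => a b ab ba.
apply: x_mono => //; have := gen_bidx a JS vJ; have := gen_bidx b JS vJ.
have := bidx_mono J (ltnW ab); have := bidx_mono J (ltnW ba).
by move: (v a) (v b) => ? ?; lia.
Qed.

(** * Core cosets and their reduced compositions *)

Definition conj_set x J := [set x ** s ** x^-1 | s in J].

Lemma core_coset p : core p -> is_coset p.
Proof. by case/andP. Qed.

Lemma core_simples p : core p -> lft p \subset simples n /\ rgt p \subset simples n.
Proof. by case/andP => /and3P[]. Qed.

Lemma core_lft p : core p -> lft p = conj_set (bot p) (rgt p).
Proof. by case/andP => _ /eqP. Qed.

Lemma core_rstable p : core p -> rstable false (rgt p) (bot p).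
Proof. by move=> /core_coset/(extremalP false)[]. Qed.

Lemma core_elts p : core p -> elts p = double_coset (lft p) (bot p) (rgt p).
Proof.
case: p => I J E pC; have [bE _ _] := extremalP false (core_coset pC).
have /and3P[_ _ /existsP[w /eqP[Ew]]] := core_coset pC.
by rewrite [LHS]Ew; apply/esym/double_coset_eq; rewrite -Ew.
Qed.

Lemma pmul_conjK x s : x ** s ** x^-1 ** x = x ** s.
Proof. by rewrite /pmul !mulgA mulgV mul1g. Qed.

(** Left minimality follows from right minimality because a letter [x ** s ** x^-1] of [I] acts on
    [x] from the left as [s] does from the right. *)
Lemma coreI I J x : I \subset simples n -> J \subset simples n ->
    I = conj_set x J -> rstable false J x ->
  core (coset_through I x J) /\ bot (coset_through I x J) = x.
Proof.
move=> IS JS IE rx; pose p := coset_through I x J.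
have pC : is_coset p by rewrite /is_coset /= IS JS; apply/existsP; exists x.
have lx : lstable false I x.
  rewrite IE; apply/forall_inP => _ /imsetP[s sJ ->]; rewrite pmul_conjK.
  exact: (forall_inP rx).
have bE : bot p = x by apply: extremal_eq pC _ lx rx; apply: double_coset_refl.
by rewrite /core pC bE /= -/(conj_set x J) -IE eqxx.
Qed.

(** A letter of the left parabolic passes through [bot p] and becomes a letter of the right one, so
    both stability conditions reduce to those of the longest element. *)
Lemma core_top p : core p -> top p = bot p ** longest (rgt p).
Proof.
move=> pC; have [IS JS] := core_simples pC; have rx := core_rstable pC.
rewrite topE; apply: extremal_eq (core_coset pC) _ _ _.
- by rewrite (core_elts pC) double_cosetMr ?longest_mem ?double_coset_refl.
- rewrite {1}(core_lft pC); apply/forall_inP => _ /imsetP[s sJ ->].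
  rewrite pmulA pmul_conjK -pmulA eqb_id -leqNgt !(len_rstableM JS rx) ?longest_mem //.
    by rewrite leq_add2l leqNgt; have /forall_inP/(_ s sJ) := longest_lstable (rgt p); rewrite eqb_id.
  by rewrite pmul_memr ?longest_mem ?mem_gen.
apply/forall_inP => s sJ; rewrite -pmulA eqb_id -leqNgt !(len_rstableM JS rx) ?longest_mem //.
  by rewrite leq_add2l leqNgt; have /forall_inP/(_ s sJ) := longest_rstable (rgt p); rewrite eqb_id.
by rewrite pmul_memr ?longest_mem ?mem_gen.
Qed.

Lemma len_top p : core p -> len (top p) = (len (bot p) + len (longest (rgt p)))%N.
Proof.
move=> pC; have [_ JS] := core_simples pC.
by rewrite core_top // (len_rstableM JS (core_rstable pC)) // longest_mem.
Qed.

Lemma len_wprod a : all [in simples n] a -> len (wprod a) <= size a.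
Proof.
elim: a => [|s a IH] /=; first by rewrite len1.
by case/andP => /len_simple s1 /IH; have := lenM s (wprod a); rewrite s1; olia.
Qed.

(** If the lengths add for the whole word they add for every suffix, so each operator really
    multiplies. *)
Lemma lopw_additive a w : all [in simples n] a ->
  len (wprod a ** w) = (size a + len w)%N -> lopw true w a = wprod a ** w.
Proof.
elim: a => [|s a IH] /=; first by rewrite pmul1p.
case/andP => sS aS; rewrite -pmulA => lenE.
have le1 := lenM s (wprod a ** w); have le2 := lenM (wprod a) w.
have := len_wprod aS; have s1 := len_simple sS => le3.
have E : len (wprod a ** w) = (size a + len w)%N by olia.
by rewrite IH // /lop eqb_id; case: ifP => // /negbT; olia.
Qed.

Lemma redwordP u :
  [/\ all [in simples n] (redword u), wprod (redword u) = u & size (redword u) = len u].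
Proof.
rewrite /redword; case: (xchoose _) (xchooseP (existsP (has_word_len u))) => ws /=.
by move=> sz /andP[-> /eqP->]; split=> //; apply/eqP.
Qed.

Lemma lopw_redword u : lopw true 1 (redword u) = u.
Proof.
have [aS aE sz] := redwordP u.
by rewrite lopw_additive ?pmulp1 ?aE ?len1 ?addn0.
Qed.

Lemma starE u w : star u w = lopw true w (redword u).
Proof.
rewrite /star /lopw; elim: (redword u) => //= s a ->.
by rewrite /star_simple /lop eqb_id.
Qed.

(* Left and right raising operators commute, so letting them act on the identity
   shows that [lopw true w a] depends on [a] only through [lopw true 1 a]. *)
Lemma star_word u w a : all [in simples n] a -> lopw true 1 a = u ->
  star u w = lopw true w a.
Proof.
move=> aS aE; have [uS _ _] := redwordP u; have [wS _ _] := redwordP w^-1.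
have -> : w = ropw true 1 (rev (redword w^-1)).
  by apply: invg_inj; rewrite ropwV ?all_rev // revK invg1 lopw_redword.
rewrite starE !lopw_ropwC ?all_rev //; last first.
by rewrite lopw_redword aE.
Qed.

(** Spell [top p] as a reduced word of [bot p] followed by a raising word of the longest element.
    The latter acts trivially on [top q], which is left maximal, and the former acts by honest
    multiplication. *)
Lemma star_core p q : core p -> core q -> rgt p = lft q ->
    len (bot p ** top q) = (len (bot p) + len (top q))%N ->
  star (top p) (top q) = bot p ** top q.
Proof.
move=> pC qC pq lenE; have [_ JS] := core_simples pC.
have [a aJ st] := ropw_stable true 1 JS.
have aE : lopw true 1 (rev a) = longest (rgt p).
  rewrite -[1]invg1 -ropwV ?(sub_simples JS) // -longestV //; congr _^-1.
  have [u uJ uE] := ropw_mem true 1 aJ; rewrite uE pmul1p in st *.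
  exact: longest_uniq.
have [bS bE sz] := redwordP (bot p).
rewrite (@star_word _ _ (redword (bot p) ++ rev a)); last 1 first.
- rewrite /lopw foldr_cat -/(lopw true 1 (rev a)) aE -/(lopw true _ _).
  rewrite lopw_additive // bE -core_top // sz len_top //.
- rewrite /lopw foldr_cat -/(lopw true (top q) (rev a)) -/(lopw true _ _).
  have -> : lopw true (top q) (rev a) = top q.
    have [_ lq _] := extremalP true (core_coset qC).
    have [qS _] := core_simples qC.
    have rq : rstable true (rgt p) (top q)^-1 by rewrite pq -(lstableV _ _ qS); exact: lq.
    apply: invg_inj; rewrite lopwV ?all_rev ?(sub_simples JS) // revK.
    exact: ropw_fix rq aJ.
  by rewrite lopw_additive // bE // sz.
by rewrite all_cat bS all_rev (sub_simples JS).
Qed.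


Lemma conj_mem x J s : s \in J -> x ** s ** x^-1 \in conj_set x J.
Proof. by move=> sJ; apply: imset_f. Qed.

Lemma conj_tperm x c d : x ** tperm c d ** x^-1 = tperm (x c) (x d).
Proof. by rewrite pmul_tperm /pmul mulKg. Qed.

Lemma conj_setMM x y K : conj_set (x ** y) K = conj_set x (conj_set y K).
Proof.
rewrite /conj_set -imset_comp; apply: eq_imset => s /=.
by rewrite pmulV !pmulA.
Qed.

(** A letter swapping neighbours of a block of [J] is conjugated to the swap of their images. This
    swap lies in [I], and elements of [<<I>>] preserve block numbers. *)
Lemma conj_bidx x I J (a b : 'I_n) : I \subset simples n -> J \subset simples n -> I = conj_set x J ->
  bidx J a = bidx J b -> bidx I (x a) = bidx I (x b).
Proof.
move=> IS JS IE; wlog ab : a b / a < b => [gen|].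
  case: (ltngtP a b) => [/gen//|/gen g /esym /g //|/val_inj-> //].
case: b ab => b; elim: b => // b IH lt_b /= lt_ab E.
have lt_b' : b < n by apply: ltnW.
have := bidx_between (b := Ordinal lt_b') (c := Ordinal lt_b) _ _ E.
move=> /(_ lt_ab (leqnSn b)) E'.
have -> : bidx I (x a) = bidx I (x (Ordinal lt_b')).
  have [/IH->//|le_ba] := ltnP a b.
  by congr (bidx I (x _)); apply: val_inj => /=; lia.
have tJ : tperm (Ordinal lt_b') (Ordinal lt_b) \in J by rewrite -bidx_eqS // E' E.
have := conj_mem x tJ; rewrite -IE conj_tperm => /mem_gen sI.
by rewrite -(gen_bidx (x (Ordinal lt_b')) IS sI) tpermL.
Qed.

Lemma core_mulP p q : core p -> core q -> rgt p = lft q ->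
  rstable false (rgt q) (bot p ** bot q) /\ lft p = conj_set (bot p ** bot q) (rgt q).
Proof.
move=> pC qC pq; have [IS JS] := core_simples pC; have [_ KS] := core_simples qC.
split; last by rewrite conj_setMM -core_lft // -pq -core_lft.
apply/(rstableP _ _ KS) => a b ab E; rewrite !pmulE.
have /(rstableP _ _ JS) p_mono := core_rstable pC.
have /(rstableP _ _ KS) q_mono := core_rstable qC.
apply: p_mono; first by rewrite q_mono.
by rewrite pq; apply: conj_bidx E; rewrite -?pq // pq core_lft.
Qed.

(** The longest element of the middle parabolic cancels in the product, and that of the right
    parabolic adds the same length to both sides; what remains is additivity for the minimal
    elements. *)
Lemma reduced_compP p q : core p -> core q -> rgt p = lft q ->
    reduced_comp p q = (len (bot p ** bot q) == len (bot p) + len (bot q))%N /\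
    (reduced_comp p q -> core (compose p q) /\ bot (compose p q) = bot p ** bot q).
Proof.
move=> pC qC pq; have [IS JS] := core_simples pC; have [_ KS] := core_simples qC.
have [rpq pqE] := core_mulP pC qC pq.
have topM : top p ** (longest (rgt p))^-1 ** top q = bot p ** top q.
  by rewrite (core_top pC) /pmul mulKg.
have lenM3 : len (bot p ** top q) = (len (bot p ** bot q) + len (longest (rgt q)))%N.
  by rewrite (core_top qC) pmulA (len_rstableM KS rpq) ?longest_mem.
have le := lenM (bot p) (bot q); have lp := len_top pC; have lq := len_top qC.
have E : reduced_comp p q = (len (bot p ** bot q) == len (bot p) + len (bot q))%N.
  rewrite /reduced_comp topM; apply/andP/eqP => [[/eqP-> /eqP]|add].
    by move: le lenM3 lp lq; clear; olia.
  have -> : star (top p) (top q) = bot p ** top q.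
    by apply: star_core => //; move: add lenM3 lq; clear; olia.
  by rewrite eqxx; split=> //; apply/eqP; move: add lenM3 lp lq; clear; olia.
split=> // /andP[/eqP st _].
have -> : compose p q = coset_through (lft p) (bot p ** bot q) (rgt q).
  rewrite /compose st topM (core_top qC) pmulA /coset_through.
  by congr DCoset; apply/double_coset_eq/double_cosetMr/double_coset_refl/longest_mem.
exact: coreI.
Qed.

End Star.

(** * Squashing *)

Section Blocks.
Variables n m : nat.
Implicit Types (a b c d : 'I_n) (s t u v w x : 'S_n) (I J K : {set 'S_n}) (p q r : dcoset n).

Lemma tperm_succ_inj a b c d : b = a.+1 :> nat -> d = c.+1 :> nat ->
  tperm a b = tperm c d -> a = c.
Proof.
move=> ab cd E; apply: val_inj => /=.
have := tpermL a b; rewrite E.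
by case: tpermP => [->//|/(congr1 val)/= ad|_ _] /(congr1 val)/=; lia.
Qed.

(** The points that are not cuts correspond to the letters of [J], each point to its swap with the
    next one. *)
Lemma card_cut J : J \subset simples n -> #|[set a | cut J a]| = n - #|J|.
Proof.
move=> /subsetP JS; suff <- : #|[set a | ~~ cut J a]| = #|J|.
  have := cardsC [set a | cut J a]; rewrite card_ord.
  have -> : ~: [set a | cut J a] = [set a | ~~ cut J a] by apply/setP => a; rewrite !inE.
  by move=> nE; rewrite -[X in (X - _)%N]nE addnK.
(* The default of [insubd] occurs only at the last point, which is always a cut. *)
pose nxt a : 'I_n := insubd a a.+1.
have nxtE a b : b = a.+1 :> nat -> nxt a = b.
  by move=> ab; apply: val_inj; rewrite val_insubd -ab ltn_ord.
have cutP a : ~~ cut J a -> exists2 b : 'I_n, b = a.+1 :> nat & tperm a b \in J.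
  by rewrite negbK => /existsP[b /andP[/eqP ab abJ]]; exists b.
rewrite -(@card_in_imset _ _ (fun a => tperm a (nxt a))).
  congr #|pred_of_set _|; apply/setP => s; apply/imsetP/idP => [[a + ->]|sJ].
    by rewrite inE => /cutP[b /nxtE->].
  have /simpleP[a [b [ab sE]]] := JS s sJ; exists a; last by rewrite (nxtE a b).
  by rewrite inE (cutE _ ab) negbK -sE.
move=> a c; rewrite !inE => /cutP[b ab _] /cutP[d cd _].
by rewrite (nxtE a b) // (nxtE c d) //; apply: tperm_succ_inj.
Qed.

(** The very last point is a cut that [bidx] never counts, whence the strict bound. *)
Lemma bidx_max J a : J \subset simples n -> #|J| = m -> bidx J a < n - m.
Proof.
move=> JS JE; have nE : #|[set b | cut J b]| = n - m by rewrite card_cut // JE.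
have lt_z : n.-1 < n by have := ltn_ord a; lia.
rewrite -nE; apply: (@leq_ltn_trans (bidx J (Ordinal lt_z))).
  by apply: bidx_mono => /=; have := ltn_ord a; lia.
apply: proper_card; apply/properP; split.
  by apply/subsetP => b; rewrite !inE => /andP[].
exists (Ordinal lt_z); rewrite !inE ?ltnn // /cut; apply/existsP => -[b /andP[/eqP/= bE _]].
by have := ltn_ord b; lia.
Qed.

(** Discrete intermediate values: block numbers start at 0, grow by at most one per point, and
    attain the largest number. *)
Lemma bidx_onto J (c : 'I_(n - m)) : J \subset simples n -> #|J| = m ->
  exists a, bidx J a = c.
Proof.
move=> JS JE; have [a lt_ca] : exists a, c <= bidx J a.
  have nE : #|[set b | cut J b]| = n - m by rewrite card_cut // JE.
  have lt_z : n.-1 < n by have := ltn_ord c; lia.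
  exists (Ordinal lt_z); rewrite -ltnS; apply: (@leq_trans (n - m)) => //.
  rewrite -nE (cardsD1 (Ordinal lt_z)) -add1n leq_add ?leq_b1 //.
  apply/subset_leq_card/subsetP => b; rewrite !inE ord_eqE /= => /andP[ne ->].
  by rewrite andbT; have := ltn_ord b; lia.
case: a lt_ca => a; elim: a => [|a IH] lt_a le_c.
  exists (Ordinal lt_a); apply/eqP; rewrite eqn_leq le_c andbT.
  by rewrite [bidx _ _](_ : _ = 0) //; apply: eq_card0 => b; rewrite !inE.
have lt_a' : a < n by apply: ltnW.
have := @bidxS n J (Ordinal lt_a') (Ordinal lt_a) erefl => E.
have [/IH//|lt_c] := leqP c (bidx J (Ordinal lt_a')).
by exists (Ordinal lt_a); move: E lt_c le_c; case: (_ \notin _); lia.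
Qed.

Lemma simE J a b : sim J a b = (bidx J a == bidx J b).
Proof.
have sym : connect_sym (fun c d : 'I_n => adj J c d || adj J d c).
  by apply: sym_connect_sym => c d; rewrite orbC.
apply/idP/eqP => [/connectP[e]|].
  elim: e a => [|c e IH] a /=; first by move=> _ ->.
  case/andP => ac /IH{}IH /IH <-; case/orP: ac => /andP[/eqP ac J_ac].
    by apply/eqP; rewrite bidx_eqS.
  by apply/esym/eqP; rewrite bidx_eqS.
wlog ab : a b / a < b => [gen|].
  case: (ltngtP a b) => [/gen//|lt E|/val_inj-> _]; last exact: connect0.
  by rewrite /sim sym; apply: gen.
case: b ab => b; elim: b => // b IH lt_b /= lt_ab E.
have lt_b' : b < n by apply: ltnW.
have := bidx_between (b := Ordinal lt_b') (c := Ordinal lt_b) _ _ E.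
move=> /(_ lt_ab (leqnSn b)) E'.
apply: (@connect_trans _ _ (Ordinal lt_b')).
  have [ab|le_ba] := ltnP a b; first by apply: IH.
  by rewrite (_ : a = Ordinal lt_b') ?connect0 //; apply: val_inj => /=; lia.
by apply: connect1; rewrite /adj eqxx -bidx_eqS //= E' E eqxx.
Qed.

Definition blk J (c : nat) : {set 'I_n} := [set a | bidx J a == c].

Lemma blocksP J C : reflect (exists a, C = blk J (bidx J a)) (C \in blocks J).
Proof.
have E a : [set b in [set: 'I_n] | sim J a b] = blk J (bidx J a).
  by apply/setP => b; rewrite !inE simE eq_sym.
apply: (iffP imsetP) => [[a _ ->]|[a ->]]; exists a => //; exact: E.
Qed.

Lemma blk_lt J a b : block_lt (blk J (bidx J a)) (blk J (bidx J b)) = (bidx J a < bidx J b).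
Proof.
apply/forall_inP/idP => [H|ab c].
  have /forall_inP/(_ b) : [forall y in blk J (bidx J b), a < y] by apply: H; rewrite inE.
  rewrite inE eqxx => /(_ isT) ab; rewrite ltn_neqAle bidx_mono 1?ltnW // andbT.
  apply/negP => /eqP E; have := H b; rewrite inE E eqxx => /(_ isT)/forall_inP/(_ a).
  by rewrite inE E eqxx => /(_ isT); lia.
rewrite inE => /eqP cE; apply/forall_inP => d; rewrite inE => /eqP dE.
by apply: (@bidx_lt _ J); rewrite cE dE.
Qed.

(** The blocks before that of [a] are the level sets of the smaller numbers, all nonempty by
    [bidx_onto]. *)
Lemma blk_count J a : J \subset simples n -> #|J| = m ->
  #|[set D in blocks J | block_lt D (blk J (bidx J a))]| = bidx J a.
Proof.
move=> JS JE; have lt_a := bidx_max a JS JE.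
have repr (d : 'I_(bidx J a)) : exists b, bidx J b = d.
  by have [b] := bidx_onto (widen_ord (ltnW lt_a) d) JS JE; exists b.
rewrite -[RHS]card_ord -cardsT -(@card_imset _ _ (fun d : 'I_(bidx J a) => blk J d)).
  congr #|pred_of_set _|; apply/setP => D; rewrite inE.
  apply/andP/imsetP => [[/blocksP[b ->]]|[d _ ->]].
    by rewrite blk_lt => ba; exists (Ordinal ba).
  by have [b bE] := repr d; rewrite -bE blk_lt bE ltn_ord; split=> //; apply/blocksP; exists b; rewrite bE.
move=> d d' /setP E; have [b bE] := repr d; have := E b; rewrite !inE bE eqxx => /esym/eqP.
exact: val_inj.
Qed.

Lemma blockE J (c : 'I_(n - m)) : J \subset simples n -> #|J| = m -> block J c = blk J c.
Proof.
move=> JS JE; have [a aE] := bidx_onto c JS JE.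
rewrite /block; case: pickP => [C /andP[/blocksP[b ->]] /=|/(_ (blk J (bidx J a)))] /=.
  by rewrite blk_count // => /eqP->.
by rewrite blk_count // aE eqxx andbT => /blocksP; case; exists a; rewrite aE.
Qed.

(** * Permutations induced on block numbers *)

Definition induces I J w (f : 'S_(n - m)) :=
  forall a (c : 'I_(n - m)), bidx J a = c -> bidx I (w a) = f c.

Lemma block_mapP I J w f : I \subset simples n -> #|I| = m -> J \subset simples n -> #|J| = m ->
  reflect (induces I J w f /\ bmono true J w) (block_map I J w f).
Proof.
move=> IS IE JS JE; apply: (iffP forallP) => [H|[ind mono] c].
  split=> [a c ac|a b ab E]; last first.
    have lt_a := bidx_max a JS JE; have /andP[_ /forall_inP/(_ a)] := H (Ordinal lt_a).
    rewrite !blockE // !inE eqxx => /(_ isT)/forall_inP/(_ b); rewrite inE /= -E eqxx.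
    by move=> /(_ isT)/implyP/(_ ab) ->.
  have /andP[/eqP E _] := H c; have : w a \in block I (f c).
    by rewrite -E imset_f // blockE // inE ac.
  by rewrite blockE // inE => /eqP.
rewrite !blockE //; apply/andP; split.
  rewrite eqEsubset; apply/andP; split; apply/subsetP => b.
    by case/imsetP => a; rewrite !inE => /eqP/ind <- ->.
  (* The preimage of [b] lies in the block numbered [c] because the induced permutation is
     injective. *)
  rewrite inE => bE; apply/imsetP; exists (w^-1 b); last by rewrite permKV.
  have lt_b := bidx_max (w^-1 b) JS JE; have := ind (w^-1 b) (Ordinal lt_b) erefl.
  rewrite permKV (eqP bE) inE => /val_inj/perm_inj ->; exact: eqxx.
apply/forall_inP => a; rewrite inE => /eqP aE; apply/forall_inP => b.
by rewrite inE => /eqP bE; apply/implyP => /mono ->; rewrite ?aE ?bE.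
Qed.

Lemma induces_uniq I J w f g : J \subset simples n -> #|J| = m ->
  induces I J w f -> induces I J w g -> f = g.
Proof.
move=> JS JE fE gE; apply/permP => c; have [a ac] := bidx_onto c JS JE.
by apply: val_inj; rewrite /= -(fE _ _ ac) (gE _ _ ac).
Qed.

Lemma core_card p : core p -> #|lft p| = #|rgt p|.
Proof.
move/core_lft ->; apply: card_imset => s t; rewrite /pmul => /mulgI.
exact: mulIg.
Qed.

Lemma squash_eq p f : core p -> #|rgt p| = m ->
  induces (lft p) (rgt p) (bot p) f -> squash m p = f.
Proof.
move=> pC JE fI; have [IS JS] := core_simples pC; have IE := core_card pC.
rewrite JE in IE; have mono := rstableP _ _ JS (core_rstable pC).
rewrite /squash /squash_perm; case: pickP => [g|/(_ f)] /=.
  by case/block_mapP => // gI _; apply: induces_uniq gI fI.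
by case/block_mapP.
Qed.

Lemma conj_setK x J : conj_set x^-1 (conj_set x J) = J.
Proof.
rewrite -conj_setMM /pmul mulgV /conj_set -[RHS]imset_id; apply: eq_imset => s.
by rewrite /pmul invg1 mulg1 mul1g.
Qed.

(** A permutation of block numbers is built from one representative per block; conjugating back by
    the inverse of [bot p] gives injectivity. Hence the default in [squash_perm] is never taken. *)
Lemma squash_induces p : core p -> #|rgt p| = m ->
  induces (lft p) (rgt p) (bot p) (squash m p).
Proof.
move=> pC JE; have [IS JS] := core_simples pC; have IE := core_card pC.
rewrite JE in IE; have LR := core_lft pC.
have repr (c : 'I_(n - m)) : exists a, bidx (rgt p) a == c :> nat.
  by have [a ac] := bidx_onto c JS JE; exists a; apply/eqP.
pose rep (i : 'I_(n - m)) := xchoose (repr i); have repP (c : 'I_(n - m)) : bidx (rgt p) (rep c) = c.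
  exact/eqP/(xchooseP (repr c)).
pose g (i : 'I_(n - m)) := Ordinal (bidx_max (bot p (rep i)) IS IE).
have g_inj : injective g.
  move=> c c' /(congr1 val)/= E; apply: val_inj => /=; rewrite -(repP c) -(repP c').
  rewrite -[rep c](permK (bot p)) -[rep c'](permK (bot p)).
  by apply: (conj_bidx JS IS _ E); rewrite LR conj_setK.
have gI : induces (lft p) (rgt p) (bot p) (perm g_inj).
  move=> a c ac; rewrite permE /=; apply: (conj_bidx IS JS LR).
  by rewrite repP.
by rewrite (squash_eq pC JE gI).
Qed.

Lemma core_mono p a b : core p -> a < b -> bidx (rgt p) a = bidx (rgt p) b ->
  bot p a < bot p b.
Proof.
move=> pC; have [_ JS] := core_simples pC.
by have mono := elimT (rstableP _ _ JS) (core_rstable pC) => ab /(mono _ _ ab) ->.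
Qed.

(** Blocks are intervals, so points with images in different blocks compare as the numbers of these
    blocks do. *)
Lemma squash_lt p a b (c d : 'I_(n - m)) : core p -> #|rgt p| = m ->
    bidx (rgt p) a = c -> bidx (rgt p) b = d -> c != d ->
  (bot p a < bot p b) = (squash m p c < squash m p d).
Proof.
move=> pC JE ac bd ne; have pI := squash_induces pC JE.
have := perm_val_eq (squash m p) c d; rewrite -(pI a c ac) -(pI b d bd).
have := @bidx_lt _ (lft p) (bot p a) (bot p b).
have := @bidx_lt _ (lft p) (bot p b) (bot p a).
by move: ne; rewrite ord_eqE; olia.
Qed.

(** [bot p] and [bot q] order any two points alike: by monotonicity inside a block, by the common
    squash across blocks. *)
Lemma squash_inj p q : core p -> core q -> rgt p = rgt q -> #|rgt p| = m ->
  squash m p = squash m q -> p = q.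
Proof.
move=> pC qC pq JE E; have [_ JS] := core_simples pC.
have KE : #|rgt q| = m by rewrite -pq.
have bE : bot p = bot q.
  (* This is the MathComp product: the inverse of [bot p] acts first, and the composite is
     increasing. *)
  suff u1 : (bot p)^-1 * bot q = 1 by apply/eqP; rewrite eq_mulVg1 u1.
  apply: incr_perm1 => x y; rewrite !permM.
  rewrite -{1}[x](permKV (bot p)) -{1}[y](permKV (bot p)).
  move: ((bot p)^-1 x) ((bot p)^-1 y) => a b lt_ab.
  have ac := bidx_max a JS JE; have bd := bidx_max b JS JE.
  have [ab|ne] := eqVneq (bidx (rgt p) a) (bidx (rgt p) b).
    case: (ltngtP a b) => [|ba|/val_inj E'].
    - by move=> {}ab'; apply: core_mono; rewrite -?pq.
    - by have := core_mono pC ba (esym ab); move: lt_ab; olia.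
    - by move: lt_ab; rewrite E' ltnn.
  have Lp := @squash_lt p a b (Ordinal ac) (Ordinal bd) pC JE erefl erefl ne.
  have aq : bidx (rgt q) a = Ordinal ac by rewrite -pq.
  have bq : bidx (rgt q) b = Ordinal bd by rewrite -pq.
  by have := squash_lt qC KE aq bq ne; rewrite -E -Lp lt_ab.
have LE : lft p = lft q by rewrite (core_lft pC) (core_lft qC) bE pq.
by case: p q pq LE bE pC qC {E KE JE JS} => [I K A] [I' K' A'] /= <- <- bE
  /core_elts/= -> /core_elts/= ->; rewrite bE.
Qed.

Lemma squash_mul p q r : core p -> core q -> core r ->
    rgt p = lft q -> lft r = lft p -> rgt r = rgt q -> bot r = bot p ** bot q ->
    #|rgt q| = m ->
  squash m r = squash m p ** squash m q.
Proof.
move=> pC qC rC pq rp rq rE KE; apply: squash_eq; [exact: rC | by rewrite rq | ].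
have JE : #|rgt p| = m by rewrite pq core_card.
move=> a c; rewrite rp rq rE !pmulE => ac.
by rewrite (squash_induces pC JE (c := squash m q c)) // pq (squash_induces qC KE ac).
Qed.

(** [bot q] inverts no pair inside a block, and for a pair from two blocks the criterion [lenM_add]
    reads the same before and after squashing. *)
Lemma squash_len p q : core p -> core q -> rgt p = lft q -> #|rgt q| = m ->
  (len (bot p ** bot q) == len (bot p) + len (bot q))%N =
  (len (squash m p ** squash m q) == len (squash m p) + len (squash m q))%N.
Proof.
move=> pC qC pq KE; have JE : #|rgt p| = m by rewrite pq core_card.
have [_ KS] := core_simples qC.
have pI := squash_induces pC JE; have qI := squash_induces qC KE.
apply/lenM_add/lenM_add => [add c d cd dc|add a b ab ba].
  have [a ac] := bidx_onto c KS KE; have [b bd] := bidx_onto d KS KE.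
  have ab : a < b by apply: (@bidx_lt _ (rgt q)); rewrite ac bd.
  have ne : d != c by rewrite ord_eqE; lia.
  have ba : bot q b < bot q a by rewrite (squash_lt qC KE bd ac).
  have := add a b ab ba; rewrite (squash_lt (c := squash m q d) (d := squash m q c) pC JE); first by [].
  - by rewrite pq (qI b d).
  - by rewrite pq (qI a c).
  - by rewrite (inj_eq perm_inj).
have ne_ab : bidx (rgt q) a != bidx (rgt q) b.
  by apply/eqP => /(core_mono qC ab); move: ba; olia.
pose c := Ordinal (bidx_max a KS KE); pose d := Ordinal (bidx_max b KS KE).
have cd : c < d by have := bidx_mono (rgt q) (ltnW ab); move: ne_ab => /=; lia.
have ne : d != c by rewrite ord_eqE eq_sym.
have dc : squash m q d < squash m q c by rewrite -(squash_lt qC KE (a := b) (b := a)).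
rewrite (squash_lt (c := squash m q d) (d := squash m q c) pC JE); first exact: add.
- by rewrite pq (qI b d).
- by rewrite pq (qI a c).
- by rewrite (inj_eq perm_inj).
Qed.

Lemma comp_squash p q : core p -> core q -> rgt p = lft q -> #|rgt q| = m ->
  reduced_comp p q =
    (len (squash m p ** squash m q) == len (squash m p) + len (squash m q))%N /\
  (reduced_comp p q -> core (compose p q) /\
     squash m (compose p q) = squash m p ** squash m q).
Proof.
move=> pC qC pq KE; have [redE compP] := reduced_compP pC qC pq.
rewrite -squash_len //; split=> // /compP[cC cE]; split=> //.
exact: squash_mul.
Qed.

End Blocks.

(** * Atomic cosets *)

Section Atomic.
Variables n m : nat.
Implicit Types (a b i j k l : 'I_n) (s t u v w x : 'S_n) (I J K M : {set 'S_n}) (p q r : dcoset n).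

Lemma longestK M : M \subset simples n -> involutive (longest M).
Proof. by move=> MS a; rewrite -{1}(longestV MS) permK. Qed.

Lemma longest_anti M a b : M \subset simples n -> a < b -> bidx M a = bidx M b ->
  longest M b < longest M a.
Proof.
move=> MS ab E; have := elimT (rstableP _ _ MS) (longest_rstable M) a b ab E.
have := perm_val_eq (longest M) a b; olia.
Qed.

(** The longest element reverses each block; a point strictly between the two images would come from
    a point strictly between [i] and [j]. *)
Lemma longest_succ M i j : M \subset simples n -> j = i.+1 :> nat -> tperm i j \in M ->
  longest M i = (longest M j).+1 :> nat.
Proof.
move=> MS ij ijM; have /eqP E : bidx M i == bidx M j by rewrite bidx_eqS.
have ji : longest M j < longest M i by apply: longest_anti; rewrite // ij.
have [le|lt] := leqP (longest M i) (longest M j).+1; first by move: ji le; olia.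
have lt_z : (longest M j).+1 < n by apply: ltn_trans (ltn_ord (longest M i)).
pose z := Ordinal lt_z; have lwM a : bidx M (longest M a) = bidx M a.
  by rewrite gen_bidx ?longest_mem.
have zE : bidx M z = bidx M i.
  have := @bidx_between n M (longest M j) z (longest M i) (leqnSn _) (ltnW lt).
  by rewrite !lwM -E; apply.
have := @longest_anti M (longest M z) i MS; have := @longest_anti M j (longest M z) MS.
rewrite !lwM zE E longestK //.
have := perm_val_eq (longest M) (longest M z) i; have := perm_val_eq (longest M) (longest M z) j.
by rewrite longestK //= ij; move: lt; olia.
Qed.

(** Dropping the letter creates a single new cut, at [k]. *)
Lemma bidxD1 M k l a : l = k.+1 :> nat -> tperm k l \in M ->
  bidx (M :\ tperm k l) a = (bidx M a + (k < a))%N.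
Proof.
move=> kl klM; have cutD b : cut (M :\ tperm k l) b = (b == k) || cut M b.
  rewrite /cut; have [->|ne] /= := eqVneq b k.
    apply/existsP => -[d /andP[/eqP dE]].
    by rewrite (_ : d = l) ?inE ?eqxx //; apply: val_inj; rewrite /= dE kl.
  congr (~~ _); apply: eq_existsb => d; rewrite /adj !inE; case: eqP => //= bd.
  by case: eqP => // /(tperm_succ_inj bd kl) E; rewrite E eqxx in ne.
rewrite /bidx (cardsD1 k) inE cutD eqxx andbT addnC; congr (_ + _)%N.
apply: eq_card => b; rewrite !inE cutD; have [->|//] := eqVneq b k.
by rewrite (cutE _ kl) klM andbF.
Qed.


Lemma longest_conj M : M \subset simples n -> conj_set (longest M) M = M.
Proof.
move=> MS; apply/eqP; rewrite eqEcard; apply/andP; split; last first.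
  rewrite card_imset // => s t; rewrite /pmul => /mulgI; exact: mulIg.
apply/subsetP => _ /imsetP[s sM ->]; have /simpleP[i [j [ij sE]]] := subsetP MS s sM.
rewrite sE in sM *; rewrite conj_tperm tpermC -bidx_eqS; last exact: longest_succ.
by rewrite !gen_bidx ?longest_mem // eq_sym bidx_eqS.
Qed.

Section AtomicCoset.
Variables (M : {set 'S_n}) (i j : 'I_n).
Hypotheses (MS : M \subset simples n) (ij : j = i.+1 :> nat) (ijM : tperm i j \in M).

Let k := longest M j.
Let l := longest M i.
Let s := tperm i j.
Let t := tperm k l.
Let q := atomic_coset M s.
(** The minimal element of the atomic coset: it exchanges the two pieces into which the cut at [k]
    divides a block of [M], keeping the order inside each piece. *)
Let x := longest M ** longest (M :\ t).

Let kl : l = k.+1 :> nat.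
Proof. exact: longest_succ. Qed.

Let tE : longest M ** s ** longest M = t.
Proof. by rewrite -{2}longestV // conj_tperm tpermC. Qed.

Let tM : t \in M.
Proof. by have := conj_mem (longest M) ijM; rewrite longest_conj // longestV // tE. Qed.

Let KS : M :\ t \subset simples n.
Proof. exact: subset_trans (subsetDl _ _) MS. Qed.

Let IS : M :\ s \subset simples n.
Proof. exact: subset_trans (subsetDl _ _) MS. Qed.

Let bidxM_eq a b : bidx (M :\ t) a = bidx (M :\ t) b -> bidx M a = bidx M b.
Proof.
rewrite !bidxD1 //; wlog ab : a b / a <= b.
  by move=> gen; case: (leqP a b) => [/gen//|/ltnW/gen g /esym/g/esym].
by have := bidx_mono M ab; case: (ltnP k a); case: (ltnP k b); lia.
Qed.

Let rx : rstable false (M :\ t) x.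
Proof.
apply/(rstableP _ _ KS) => a b ab E; rewrite !pmulE.
have wE c : bidx M (longest (M :\ t) c) = bidx M c.
  by apply: gen_bidx => //; apply: subsetP (genS (subsetDl _ _)) _ (longest_mem _).
by apply: longest_anti; rewrite ?wE; [ | apply: longest_anti | apply/esym/bidxM_eq].
Qed.

Let IE : M :\ s = conj_set x (M :\ t).
Proof.
rewrite conj_setMM longest_conj //; apply/esym/eqP; rewrite eqEcard; apply/andP; split.
  apply/subsetP => _ /imsetP[v /setD1P[vt vM] ->]; rewrite !inE.
  have := conj_mem (longest M) vM; rewrite longest_conj // => ->; rewrite andbT.
  apply: contraNneq vt => vs; rewrite -tE -/s -vs.
  have w2 : longest M * longest M = 1 by rewrite -{1}longestV // mulVg.
  by rewrite /pmul !mulgA mulgV mul1g -!mulgA w2 mulg1.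
rewrite card_imset; last by move=> u v; rewrite /pmul => /mulgI; exact: mulIg.
by have := cardsD1 s M; rewrite (cardsD1 t M) tM ijM => /addnI ->.
Qed.

Lemma atomic_rgt : rgt q = M :\ t.
Proof. by rewrite /q /atomic_coset /= tE. Qed.

Lemma atomic_core_bot : core q /\ bot q = x.
Proof.
have -> : q = coset_through (M :\ s) x (M :\ t).
  rewrite /q /atomic_coset tE /coset_through; congr DCoset.
  by apply/esym/double_coset_eq/double_cosetMr/double_coset_refl/longest_mem.
exact: coreI.
Qed.

Let xM a : bidx M (x a) = bidx M a.
Proof.
rewrite pmulE !gen_bidx ?longest_mem //.
by apply: subsetP (genS (subsetDl _ _)) _ (longest_mem _).
Qed.

Let bidx_kl : bidx M k = bidx M l.
Proof. by apply/eqP; rewrite bidx_eqS. Qed.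

Let bidx_i : bidx M i = bidx M k.
Proof. by rewrite /k gen_bidx ?longest_mem //; apply/eqP; rewrite bidx_eqS. Qed.

Let bidxK_l : bidx (M :\ t) l = (bidx (M :\ t) k).+1.
Proof. by rewrite !bidxD1 // bidx_kl kl ltnSn ltnn addn0 addn1. Qed.

Let x_lk : x l < x k.
Proof.
rewrite !pmulE; set u := longest (M :\ t).
have uK a : bidx (M :\ t) (u a) = bidx (M :\ t) a by rewrite gen_bidx ?longest_mem.
have uM a : bidx M (u a) = bidx M a by apply: bidxM_eq.
apply: longest_anti => //; last by rewrite !uM.
have lt1 : u k < l by apply: (@bidx_lt _ (M :\ t)); rewrite uK bidxK_l.
have lt2 : k < u l by apply: (@bidx_lt _ (M :\ t)); rewrite uK bidxK_l.
by move: lt1 lt2 kl; olia.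
Qed.

Lemma atomic_squash (c d : 'I_(n - m)) : #|M :\ t| = m -> bidx (M :\ t) k = c -> d = c.+1 :> nat ->
  squash m q = tperm c d.
Proof.
move=> KE kc cd; have [qC xE] := atomic_core_bot.
have qK : #|rgt q| = m by rewrite atomic_rgt.
have ld : bidx (M :\ t) l = d by rewrite bidxK_l kc cd.
have cM : bidx M k = c by rewrite -kc bidxD1 // ltnn addn0.
have fix_f e : e != c -> e != d -> squash m q e = e.
  move=> ec ed; have [a ae] := bidx_onto e KS KE.
  have := squash_induces qC qK; rewrite /induces atomic_rgt xE => /(_ a e ae) fE.
  (* Since [x] preserves the blocks of [M], a point outside the divided block stays on the same side
     of it and keeps its number. *)
  apply: val_inj => /=; rewrite -fE /= bidxD1 // xM; move: (ae); rewrite bidxD1 // => ae'.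
  have := @bidx_lt _ M i (x a); have := @bidx_lt _ M (x a) i; rewrite xM bidx_i cM.
  have := @bidx_lt _ (M :\ t) k a; have := @bidx_lt _ (M :\ t) a l; rewrite kc ld ae.
  by move: ae' ec ed kl cd; rewrite !ord_eqE; olia.
have lt_f : squash m q d < squash m q c.
  rewrite -(@squash_lt n m q l k) ?xE // ?atomic_rgt //.
  by rewrite ord_eqE cd gtn_eqF.
(* All other numbers are fixed, so [c] and [d] are permuted among themselves; the inversion [lt_f]
   forces the swap. *)
have in_cd e : (e == c) || (e == d) -> (squash m q e == c) || (squash m q e == d).
  apply: contraTT; rewrite !negb_or => /andP[fc fd]; have := fix_f _ fc fd.
  by move=> /perm_inj fe; rewrite fe in fc fd; rewrite fc fd.
have := in_cd c; have := in_cd d; rewrite !eqxx orbT /= => /(_ isT) + /(_ isT).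
move=> fd fc; have [Ec Ed] : squash m q c = d /\ squash m q d = c.
  move: lt_f; case/orP: fc => /eqP->; case/orP: fd => /eqP->; rewrite ?ltnn //.
  by rewrite cd ltnNge leqnSn.
apply/permP => e; case: tpermP => [->|->|/eqP ec /eqP ed] //; exact: fix_f.
Qed.

End AtomicCoset.

End Atomic.

(** * Expressions and words *)

HB.instance Definition _ n :=
  Choice.copy (dcoset n) (can_type (@dcoset_tupleK n)).

Lemma surj_bijective (A : choiceType) (B : eqType) (f : A -> B) :
  injective f -> (forall b, exists a, f a = b) -> bijective f.
Proof.
move=> f_inj f_surj; have ex b : exists a, f a == b.
  by have [a <-] := f_surj b; exists a.
pose g b := xchoose (ex b); have fK b : f (g b) = b by exact/eqP/(xchooseP (ex b)).
by exists g => // a; apply: f_inj; rewrite fK.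
Qed.

Section LenStep.
Variables (N k : nat) (x y w : 'S_N).
Hypotheses (y1 : len y = 1%N) (wk : len w <= k).

Lemma len_mul_step : (len (x ** y) == len x + len y)%N ->
  (len (x ** y ** w) == len (x ** y) + k)%N = (len (x ** (y ** w)) == len x + k.+1)%N.
Proof. by rewrite y1 => /eqP->; rewrite pmulA addn1 addSnnS. Qed.

(** A length lost in the first product cannot be recovered, since later letters add at most one
    each. *)
Lemma len_mul_nostep : ~~ (len (x ** y) == len x + len y)%N ->
  ~~ (len (x ** (y ** w)) == len x + k.+1)%N.
Proof.
have := lenM x y; have := lenM (x ** y) w; rewrite pmulA y1.
by move: (len (x ** y ** w)) (len (x ** y)) (len x) (len w) wk => ? ? ? ?; lia.
Qed.

End LenStep.

Section Words.
Variables n m : nat.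
Implicit Types (I J K M : {set 'S_n}) (p q r : dcoset n) (e : seq (dcoset n)).

Lemma atomic_simple q : atomic q -> #|rgt q| = m -> core q /\ squash m q \in simples (n - m).
Proof.
case/existsP => M /existsP[s /and3P[MS sM /eqP->]].
have /simpleP[i [j [ij sE]]] := subsetP MS s sM; rewrite sE in sM *.
rewrite (atomic_rgt i j MS) => KE; have [qC _] := atomic_core_bot MS ij sM.
split=> //; set K := M :\ _ in KE.
have KS : K \subset simples n := subset_trans (subsetDl _ _) MS.
have kl := longest_succ MS ij sM.
have lK : bidx K (longest M i) = (bidx K (longest M j)).+1.
  by rewrite (bidxS K kl) setD11 addn1.
have lt_d : (bidx K (longest M j)).+1 < n - m by rewrite -lK bidx_max.
pose c := Ordinal (ltnW lt_d); pose d := Ordinal lt_d.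
by rewrite (@atomic_squash n m M i j MS ij sM c d) // simple_tperm.
Qed.

(** Walking down from a point of block [d] leads to the boundary with block [c]. *)
Lemma bidx_cut K (c d : 'I_(n - m)) : K \subset simples n -> #|K| = m -> d = c.+1 :> nat ->
  exists k l : 'I_n, [/\ l = k.+1 :> nat, bidx K k = c & bidx K l = d].
Proof.
move=> KS KE cd; have [[a]] := bidx_onto d KS KE.
elim: a => [|a IH] lt_a aE.
  by move: aE; rewrite cd [bidx _ _](_ : _ = 0) //; apply: eq_card0 => b; rewrite !inE.
have lt_a' : a < n by apply: ltnW.
have := @bidxS n K (Ordinal lt_a') (Ordinal lt_a) erefl; rewrite aE.
case: (_ \in _); first by rewrite addn0 => /esym/IH.
rewrite addn1 cd => -[E].
by exists (Ordinal lt_a'), (Ordinal lt_a); rewrite aE cd.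
Qed.

(** Merge the two neighbouring blocks by adding to [K] the letter [t] across their boundary; the
    letter removed on the left is the conjugate of [t] by the longest element of the enlarged
    set. *)
Lemma lift_atomic K s : K \subset simples n -> #|K| = m -> s \in simples (n - m) ->
  exists q, [/\ atomic q, rgt q = K & squash m q = s].
Proof.
move=> KS KE /simpleP[c [d [cd ->]]].
have [k [l [kl kc ld]]] := bidx_cut KS KE cd.
pose t := tperm k l; pose M := t |: K.
have MS : M \subset simples n by rewrite subUset sub1set simple_tperm.
have tK : t \notin K by have := bidxS K kl; rewrite kc ld cd; case: (_ \in K) => //; lia.
have MK : M :\ t = K by rewrite setU1K.
pose i := longest M l; pose j := longest M k.
have tM : t \in M by rewrite setU11.
have ij : j = i.+1 :> nat by apply: longest_succ.
have ijM : tperm i j \in M.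
  by have := conj_mem (longest M) tM; rewrite longest_conj // conj_tperm tpermC.
have kE : longest M j = k by rewrite /j longestK.
have lE : longest M i = l by rewrite /i longestK.
exists (atomic_coset M (tperm i j)); split.
- by apply/existsP; exists M; apply/existsP; exists (tperm i j); rewrite MS ijM eqxx.
- by rewrite atomic_rgt // kE lE MK.
- by apply: atomic_squash; rewrite // kE lE MK.
Qed.

(** The left parabolic at which [e] begins; an empty expression begins where it ends, at [J]. *)
Definition source J e := if e is q :: _ then lft q else J.

Fixpoint chain J e := if e is q :: e' then (rgt q == source J e') && chain J e' else true.

Lemma chain_simples J e : J \subset simples n -> #|J| = m -> all (@atomic n) e -> chain J e ->
  [/\ source J e \subset simples n, #|source J e| = m
    & all [in simples (n - m)] [seq squash m q | q <- e]].
Proof.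
move=> JS JE; elim: e => //= q e IH /andP[qA eA] /andP[/eqP qe /(IH eA)[sS sE ->]].
have qE : #|rgt q| = m by rewrite qe.
have [qC ->] := atomic_simple qA qE; have [IS _] := core_simples qC.
by split=> //; rewrite core_card.
Qed.

(** The successive reducedness tests merge into one: each atomic factor squashes to length one, so
    they all succeed iff the full squashed product has the largest possible length. *)
Lemma reduced_fromP J p e : J \subset simples n -> #|J| = m -> all (@atomic n) e -> chain J e ->
    core p -> rgt p = source J e ->
    let f := squash m p ** wprod [seq squash m q | q <- e] in
  reduced_from p e = (len f == len (squash m p) + size e)%N /\
  (reduced_from p e -> let r := foldl (@compose n) p e in
    [/\ core r, rgt r = J & squash m r = f]).
Proof.
move=> JS JE; elim: e p => [|q e IH] p /=; first by rewrite pmulp1 addn0 eqxx.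
case/andP => qA eA /andP[/eqP qe e_chain] pC pq.
have [sS sE eS] := chain_simples JS JE eA e_chain.
have qE : #|rgt q| = m by rewrite qe.
have [qC qS] := atomic_simple qA qE.
have [redE red] := comp_squash pC qC pq qE.
rewrite pq eqxx /=; have [pqR|] := boolP (reduced_comp p q).
  have [cC cE] := red pqR; have [] := IH (compose p q) eA e_chain cC qe.
  rewrite cE /= => -> H; split; last by rewrite pmulA.
  by apply: len_mul_step (len_simple qS) _; rewrite -redE.
rewrite redE => ne; split=> //; apply/esym/negbTE.
apply: len_mul_nostep (len_simple qS) _ ne.
by have := len_wprod eS; rewrite size_map.
Qed.

Lemma reduced_from_chain p e : reduced_from p e ->
  let J := rgt (foldl (@compose n) p e) in rgt p = source J e /\ chain J e.
Proof.
elim: e p => //= q e IH p /and3P[/eqP pq _ /IH[<- ->]]; split=> //.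
by rewrite eqxx.
Qed.

Lemma id_coset_core I : I \subset simples n -> #|I| = m ->
  core (id_coset I) /\ squash m (id_coset I) = 1.
Proof.
move=> IS IE.
have I1 : I = conj_set 1 I.
  by rewrite -{1}[I]imset_id; apply: eq_imset => s; rewrite invg1 pmulp1 pmul1p.
have r1 : rstable false I 1.
  by apply/(rstableP _ _ IS) => a b ab _; rewrite !perm1.
have [C b1] := coreI IS IS I1 r1; split=> //; apply: squash_eq => // a c ac.
by rewrite b1 !perm1.
Qed.

(** Only the parabolics still tie the factors together; a composite squashing to [squash m p] equals
    [p] by [squash_inj]. *)
Lemma atomic_rexE p e : core p -> #|rgt p| = m ->
  atomic_rex p e =
    [&& all (@atomic n) e, chain (rgt p) e
      & reduced_word (squash m p) [seq squash m q | q <- e]].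
Proof.
move=> pC JE; have [_ JS] := core_simples pC; set J := rgt p in JE JS *.
have [idC idE] := id_coset_core JS JE.
case: e => [|q e].
  rewrite /= /reduced_word /=; apply/eqP/andP => [pE|[/eqP E _]].
    have lE : lft p = J by rewrite /J pE.
    by rewrite pE lE idE len1 eqxx.
  have pE : p = id_coset J by apply: (squash_inj pC idC erefl JE); rewrite idE E.
  by rewrite {1}pE; congr id_coset; rewrite pE.
rewrite /= /reduced_word /= size_map; apply/and3P/and3P.
  move=> [/andP[qA eA] qR /eqP pE]; have := reduced_from_chain qR.
  rewrite pE => -[qe e_chain]; have [sS sE eS] := chain_simples JS JE eA e_chain.
  have qE : #|rgt q| = m by rewrite qe.
  have [qC qS] := atomic_simple qA qE.
  have [redE red] := reduced_fromP JS JE eA e_chain qC qe.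
  have [_ _] := red qR; rewrite pE => E; rewrite qA eA qe eqxx e_chain qS eS E eqxx.
  by split=> //; rewrite redE (len_simple qS) add1n in qR; rewrite (eqP qR) /=.
move=> [/andP[qA eA] /andP[/eqP qe e_chain] /and3P[/andP[qS eS] /eqP wE /eqP szE]].
have [sS sE _] := chain_simples JS JE eA e_chain.
have qE : #|rgt q| = m by rewrite qe.
have [qC _] := atomic_simple qA qE.
have [redE red] := reduced_fromP JS JE eA e_chain qC qe.
have qR : reduced_from q e by rewrite redE wE (len_simple qS) -szE add1n eqxx.
rewrite qA eA qR; split=> //; have [rC rE rS] := red qR.
by apply/eqP/(squash_inj rC pC rE _ (etrans rS wE)); rewrite rE.
Qed.

(** Read from the right: each factor is determined by its squash and its right parabolic, which the
    factors after it fix. *)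
Lemma chain_inj J e1 e2 : J \subset simples n -> #|J| = m ->
    all (@atomic n) e1 -> chain J e1 -> all (@atomic n) e2 -> chain J e2 ->
  [seq squash m q | q <- e1] = [seq squash m q | q <- e2] -> e1 = e2.
Proof.
move=> JS JE; elim: e1 e2 => [|q1 e1 IH] [|q2 e2]; [by []|by []|by []|rewrite 2!map_cons].
move=> /andP[qA1 eA1] /andP[/eqP qe1 ch1] /andP[qA2 eA2] /andP[/eqP qe2 ch2] eq_sq.
have E := IH e2 eA1 ch1 eA2 ch2 (congr1 behead eq_sq); rewrite -E in qe2 *; congr (_ :: _).
have [_ sE _] := chain_simples JS JE eA1 ch1.
have c1 : #|rgt q1| = m by rewrite qe1.
have c2 : #|rgt q2| = m by rewrite qe2.
have [qC1 _] := atomic_simple qA1 c1; have [qC2 _] := atomic_simple qA2 c2.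
exact: squash_inj qC1 qC2 (etrans qe1 (esym qe2)) c1 (congr1 (head 1) eq_sq).
Qed.

Lemma chain_lift J ws : J \subset simples n -> #|J| = m -> all [in simples (n - m)] ws ->
  exists e, [/\ all (@atomic n) e, chain J e & [seq squash m q | q <- e] = ws].
Proof.
move=> JS JE; elim: ws => [_|s ws IH /= /andP[sS /IH[e [eA e_chain <-]]]].
  by exists [::].
have [sE sC _] := chain_simples JS JE eA e_chain.
have [q [qA qe <-]] := lift_atomic sE sC sS.
by exists (q :: e); rewrite /= qA eA qe eqxx.
Qed.

(** Compose the lift of a reduced word of [f]; the empty word gives the identity coset. *)
Lemma squash_onto J (f : 'S_(n - m)) : J \subset simples n -> #|J| = m ->
  exists p, [/\ core p, rgt p = J & squash m p = f].
Proof.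
move=> JS JE; have [fS fE sz] := redwordP f.
have [[|q e] [eA e_chain eE]] := chain_lift JS JE fS.
  have [idC idE] := id_coset_core JS JE; exists (id_coset J).
  by rewrite idE -fE -eE.
move: eA e_chain => /= /andP[qA eA] /andP[/eqP qe e_chain].
have [sS sE eS] := chain_simples JS JE eA e_chain.
have qE : #|rgt q| = m by rewrite qe.
have [qC qS] := atomic_simple qA qE.
have [redE red] := reduced_fromP JS JE eA e_chain qC qe.
have wE : squash m q ** wprod [seq squash m q0 | q0 <- e] = f by rewrite -fE -eE.
have qR : reduced_from q e.
  by rewrite redE wE -sz -eE /= size_map (len_simple qS).
by have [rC rJ rE] := red qR; exists (foldl (@compose n) q e); rewrite rE.
Qed.

End Words.

Theorem theorem1p14 (n m : nat) (J : {set 'S_n})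
    (hJ : J \subset simples n) (hm : #|J| = m) :
  bijective
    (fun Ip : {Ip : {set 'S_n} * {set 'S_n} | core (DCoset Ip.1 J Ip.2)} =>
       squash m (DCoset (sval Ip).1 J (sval Ip).2))
  /\
  (forall p : dcoset n, core p -> rgt p = J ->
     exists f : {e : seq (dcoset n) | atomic_rex p e} ->
                {ws : seq 'S_(n - m) | reduced_word (squash m p) ws},
       bijective f /\
       (forall e, sval (f e) = [seq squash m q | q <- sval e])).
Proof.
split.
  apply: surj_bijective => [[[I E] /= C] [[I' E'] /= C'] /= eq_sq|f].
    by apply: val_inj => /=; case: (squash_inj C C' erefl hm eq_sq) => -> ->.
  have [[I J' E] [/= pC EJ sqE]] := squash_onto f hJ hm.
  by rewrite EJ in pC sqE; exists (exist _ (I, E) pC).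
move=> p pC pJ; have JE : #|rgt p| = m by rewrite pJ.
have rexE e := atomic_rexE e pC JE.
have redP (e : {e : seq (dcoset n) | atomic_rex p e}) :
    reduced_word (squash m p) [seq squash m q | q <- sval e].
  by have := svalP e; rewrite rexE => /and3P[].
exists (fun e => exist (fun ws => reduced_word (squash m p) ws) _ (redP e)); split; last by [].
apply: surj_bijective => [e1 e2 /(congr1 sval)/= eq_sq|ws].
  have := svalP e1; have := svalP e2; rewrite !rexE pJ => /and3P[A2 C2 _] /and3P[A1 C1 _].
  by apply: val_inj; apply: (chain_inj hJ hm A1 C1 A2 C2 eq_sq).
have [wsS wsE sz] := and3P (svalP ws).
have [e [eA e_chain eE]] := chain_lift hJ hm wsS.
have eR : atomic_rex p e by rewrite rexE eA pJ e_chain eE (svalP ws).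
by exists (exist _ e eR); apply: val_inj.
Qed.
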